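(* Let $\xi\sim F(\mu,\rho)$ be a Feller random measure with parameters $\mu$ and $\rho$, and let $f,f_0:[0,\infty)\to\mathbb{R}$ be continuous functions which vanish at $0$. 1. For every $t\ge0$ the cumulants of $(f*\xi)(t)$ are given by $\kappa_n[(f*\xi)(t)]=n!\,(K_n*\mu)(t)$ for $n\ge1$, where the locally bounded functions $K_n$ on $[0,\infty)$ are defined recursively by $$K_1=f*\rho,\qquad K_n=\tfrac12\Big(\sum_{i=1}^{n-1}K_iK_{n-i}\Big)*\rho\quad\text{for } n\ge2.$$ 2. If $\sup f_0<1/2$, then for every $t\ge0$ the partial cumulants are given by $\kappa_n[(f_0*\xi)(t),(f*\xi)(t)]=n!\,(K'_n*\mu)(t)$ for $n\ge1$, where $\{K'_n\}_{n\ge0}$ is the unique sequence of locally bounded functions on $[0,\infty)$ solving the system $$K'_0=h[f_0],\qquad K'_1=f*\rho+(K'_0K'_1)*\rho,\qquad K'_n=\tfrac12\Big(\sum_{i=0}^nK'_iK'_{n-i}\Big)*\rho\quad\text{for }n\ge2.$$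
   Context: $(f*\kappa)(t)=\int_{[0,t]}f(t-s)\,\kappa(ds)$. ''Locally bounded'' means Borel and bounded on each $[0,T]$. The cumulants $\kappa_n[Y]$, $n\ge1$, of a random variable $Y$ are defined by $\mathbb{E}[e^{\varepsilon Y}]=\exp(\sum_{n\ge1}\frac{\varepsilon^n}{n!}\kappa_n[Y])$ for $\varepsilon$ in a neighborhood of $0$; the partial cumulants $\kappa_n[X,Y]$, $n\ge0$, by $\mathbb{E}[e^{X+\varepsilon Y}]=\exp(\sum_{n\ge0}\frac{\varepsilon^n}{n!}\kappa_n[X,Y])$ for $\varepsilon$ in a neighborhood of $0$ (the claim includes that these expansions hold). Feller random measure: let $\mu$ be a measure on $[0,\infty)$ finite on bounded sets, and $\rho$ a probability measure on $[0,\infty)$ with $\rho(\{0\})=0$ whose Laplace transform is $\hat\rho=1/(1-\log\hat\nu)$ for some infinitely divisible probability measure $\nu$ on $[0,\infty)$. $F(\mu,\rho)$ is the law of the locally finite random measure $\xi$ on $[0,\infty)$ uniquely characterized by $\mathbb{E}[e^{(g*\xi)(t)}]=e^{(h[g]*\mu)(t)}$, $t\ge0$, for all continuous $g$ with $g(0)=0$, $|g|\le1/2$, where $h[g]$ is the unique locally bounded solution of $h=(g+\frac12h^2)*\rho$; the notation $h[f_0]$ likewise denotes the unique locally bounded solution of this equation with $g=f_0$. (Existence and uniqueness of the law may be taken as known.) *)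

(* Defs.v *)
From mathcomp Require Import all_boot all_order all_algebra.
From mathcomp Require Import all_classical all_reals all_analysis.

Set Implicit Arguments.
Unset Strict Implicit.
Unset Printing Implicit Defensive.

Import Order.TTheory GRing.Theory Num.Theory.
Import numFieldNormedType.Exports.

Local Open Scope classical_set_scope.
Local Open Scope ring_scope.

(* A function on [0,oo) is a function R -> R whose values at negative arguments
   are never used; a measure on [0,oo) is a Borel measure on R that gives mass 0
   to ]-oo,0[. *)

Section Convolution.
Variable R : realType.
Local Notation borel := (measurableTypeR R).

Definition convol (f : R -> R) (k : {measure set borel -> \bar R}) (t : R) : R :=
  \int[k]_(s in `[0, t]) f (t - s).

Definition loc_bounded (h : R -> R) : Prop :=
  measurable_fun (`[0%R, +oo[%classic : set borel) (h : borel -> borel) /\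
  forall T : R, exists M : R, forall x : R, 0 <= x <= T -> `|h x| <= M.

Definition continuous_vanishing0 (f : R -> R) : Prop :=
  {within `[0, +oo[%classic, continuous f} /\ f 0 = 0.

Definition loc_finite_meas (m : {measure set borel -> \bar R}) : Prop :=
  m `]-oo, 0%R[%classic = 0%E /\ forall T : R, (m `[0%R, T]%classic < +oo)%E.

End Convolution.

Section FellerParameters.
Variable R : realType.
Local Notation borel := (measurableTypeR R).

(* n-fold convolution power of m : m^{*(n+1)}(A) = \int m^{*n}(A - x) m(dx) *)
Fixpoint conv_power (m : {measure set borel -> \bar R}) (n : nat) :
    set borel -> \bar R :=
  if n is n'.+1 then
    fun A => (\int[m]_x conv_power m n' [set y : R | A (x + y)%R])%E
  else (\d_ (0%R : borel) : set borel -> \bar R).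

Definition infinitely_divisible (nu : probability borel R) : Prop :=
  forall n : nat, (0 < n)%N -> exists nu_n : probability borel R,
    forall A : set borel, measurable A -> nu A = conv_power nu_n n A.

Definition laplace (m : {measure set borel -> \bar R}) (lam : R) : R :=
  \int[m]_(x in `[0, +oo[) expR (- (lam * x)).

Definition feller_kernel (rho : probability borel R) : Prop :=
  [/\ rho `]-oo, 0%R[%classic = 0%E, rho [set 0] = 0%E &
    exists nu : probability borel R,
      [/\ nu `]-oo, 0%R[%classic = 0%E, infinitely_divisible nu &
        forall lam : R, 0 <= lam ->
          laplace rho lam = 1 / (1 - ln (laplace nu lam))]].

(* h is a version of h[g]; h[g] is determined on [0,oo) only. *)
Definition is_hsol (rho : probability borel R) (g h : R -> R) : Prop :=
  loc_bounded h /\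
  forall t : R, 0 <= t -> h t = convol (fun s => g s + 2^-1 * h s ^+ 2) rho t.

(* xi ~ F(mu, rho): a random measure is a kernel from the sample space, and its
   law is identified through its Laplace functional. *)
Definition feller_random_measure d (Omega : measurableType d)
    (P : probability Omega R) (xi : R.-ker Omega ~> borel)
    (mu : {measure set borel -> \bar R}) (rho : probability borel R) : Prop :=
  (forall w : Omega, loc_finite_meas (xi w)) /\
  forall g h : R -> R, continuous_vanishing0 g ->
    (forall x : R, 0 <= x -> `|g x| <= 2^-1) ->
    is_hsol rho g h ->
    forall t : R, 0 <= t ->
      'E_P[fun w => expR (convol g (xi w) t)]%E = (expR (convol h mu t))%:E.

End FellerParameters.

Section Cumulants.
Variables (R : realType) (d : measure_display) (Omega : measurableType d).
Variable P : probability Omega R.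

(* kappa n = kappa_n[Y] for n >= 1; the value kappa 0 is irrelevant. *)
Definition has_cumulants (Y : Omega -> R) (kappa : nat -> R) : Prop :=
  exists2 delta : R, 0 < delta & forall eps : R, `|eps| < delta ->
    exists2 l : R,
      (fun N => \sum_(1 <= n < N) eps ^+ n / n`!%:R * kappa n) @ \oo --> l &
      'E_P[fun w => expR (eps * Y w)]%E = (expR l)%:E.

(* kappa n = kappa_n[X, Y] for n >= 0 *)
Definition has_partial_cumulants (X Y : Omega -> R) (kappa : nat -> R) : Prop :=
  exists2 delta : R, 0 < delta & forall eps : R, `|eps| < delta ->
    exists2 l : R,
      (fun N => \sum_(0 <= n < N) eps ^+ n / n`!%:R * kappa n) @ \oo --> l &
      'E_P[fun w => expR (X w + eps * Y w)]%E = (expR l)%:E.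

End Cumulants.

Section CumulantFunctions.
Variable R : realType.
Local Notation borel := (measurableTypeR R).
Variable rho : probability borel R.

(* Course-of-values recursion: Ktable f n i is K_i for 1 <= i <= n and 0 for the
   other i; the recursion satisfied by Kfun is Kfun1 and KfunE below. *)
Fixpoint Ktable (f : R -> R) (n : nat) : nat -> R -> R :=
  if n is n'.+1 then
    let K := Ktable f n' in
    let Kn := if n' == 0%N then convol f rho else
      convol (fun s => 2^-1 * \sum_(1 <= i < n) K i s * K (n - i)%N s) rho in
    fun i => if i == n then Kn else K i
  else fun _ _ => 0.

Definition Kfun (f : R -> R) (n : nat) : R -> R := Ktable f n n.

Lemma Kfun1 f : Kfun f 1 = convol f rho.
Proof. by []. Qed.

Lemma KtableE f m i : (i <= m)%N -> Ktable f m i = Kfun f i.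
Proof.
elim: m => [|m IH]; first by rewrite leqn0 => /eqP ->.
rewrite leq_eqVlt => /orP[/eqP -> //|im].
by rewrite [LHS]/= ltn_eqF//; exact: IH.
Qed.

Lemma KfunE f n : (2 <= n)%N -> Kfun f n =
  convol (fun s => 2^-1 * \sum_(1 <= i < n) Kfun f i s * Kfun f (n - i) s) rho.
Proof.
case: n => [//|[//|n]] _; rewrite {1}/Kfun [LHS]/= eqxx.
congr (convol _ rho); apply/funext => s; congr (_ * _).
rewrite [LHS]big_nat [RHS]big_nat; apply: eq_bigr => i /andP[i1 i2].
rewrite -!(@KtableE f n.+1)//.
by case: i i1 i2 => // i _ _; rewrite subSS leq_subr.
Qed.

(* The index n = 0 of the system: K 0 is h[f0]. *)
Definition Kprime_system (f0 f : R -> R) (K : nat -> R -> R) : Prop :=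
  [/\ forall n, loc_bounded (K n),
      is_hsol rho f0 (K 0%N),
      forall t : R, 0 <= t ->
        K 1%N t = convol f rho t + convol (fun s => K 0%N s * K 1%N s) rho t &
      forall n, (2 <= n)%N -> forall t : R, 0 <= t ->
        K n t =
        convol (fun s => 2^-1 * \sum_(0 <= i < n.+1) K i s * K (n - i)%N s) rho t].

End CumulantFunctions.

(* Main.v *)
Require Import Defs.
From HB Require Import structures.
From mathcomp Require Import all_boot all_order all_algebra.
From mathcomp Require Import all_classical all_reals all_analysis.
From mathcomp Require Import measurable_realfun.
From mathcomp Require Import ring lra zify.
Import Order.TTheory GRing.Theory Num.Theory.
Import numFieldNormedType.Exports.
Local Open Scope classical_set_scope.
Local Open Scope ring_scope.

Set Implicit Arguments.
Unset Strict Implicit.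
Unset Printing Implicit Defensive.

(** The system for the K'_n says that the formal power series h = sum eps^n K'_n solves
    h = (g + h^2/2) * rho with g = f0 + eps f. Three facts turn this into the theorem:
    the formal series exists, is unique and converges, locally uniformly, for small
    eps; the exponential moment of (g * xi)(t) is exp ((h * mu)(t)) for the g at hand,
    although these need not satisfy |g| <= 1/2; and integrating the series against mu
    term by term identifies the cumulants. The first part is the case f0 = 0, in which
    K'_0 vanishes and the system becomes the recursion for K_n
    (Kfun_formal_solution).

    Convergence. As rho has no atom at 0, convolution with rho is a contraction in the
    norm sup e^{-beta t} |u t| for large beta. Hence linear Volterra equations are
    uniquely solvable with bounds on every [0, T] (volterra_exists, volterra_bound),
    and the sup norms of the K'_n are dominated by the coefficients of the solution of
    a quadratic equation (formal_solution_majorant, formal_solution_sum).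

    Existence of h[g]. If g is only bounded above by 1/2 - delta, the equation
    h = (g + h^2/2) * rho could explode for a general rho. Here the special form of rho
    enters, through a maximum principle: if u = phi * rho, then at a maximum of u one
    has u <= phi, up to an arbitrary error (causal_max_principle). Indeed phi = u + L u
    where -L is the generator of minus the subordinator whose increment over a unit of
    time has law nu; L u is the limit of n (u - u * nu_n), where nu_n is the n-th
    convolution root of nu, and u - u * nu_n >= 0 at a maximum. To avoid any regularity
    question this is carried out for polynomials in e^t, on which L acts diagonally
    (poly_max_principle), and extended by the Weierstrass theorem. At a maximum of h
    above 1 the equation, with the square cut off at height 1, would give
    h <= (1/2 - delta) + 1/2, so h <= 1 (quadratic_volterra_exists).

    Exponential moments. For such a g consider z g with 0 <= z <= 1. For small z the
    formula is the definition of xi. At every z both sides have expansions converging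
    in a disc whose radius does not depend on z: the moment because e^{z (g * xi)(t)}
    stays integrable slightly beyond [0, 1] (mgf_power_series), the other side by the
    convergence above. Two such functions y and e^h that agree on the left of a point
    agree in the whole disc, since y' = h' y is an identity between power series
    (psum_exp_continuation). Finitely many steps lead to z = 1 (ray_formula1). *)

(** * Absolutely convergent series and power series *)

Section Series.
Variable R : realType.
Implicit Types (u v : nat -> R) (A B C l lu lv : R).

Lemma abs_bounded_series_cvg u C :
  (forall N, \sum_(0 <= n < N) `|u n| <= C) -> cvgn (series u).
Proof.
move=> uC; apply: normed_cvg; apply: nondecreasing_is_cvgn.
  by apply: nondecreasing_series => n _ _; exact: normr_ge0.
by exists C => _ [N _ <-]; exact: uC.
Qed.

Lemma abs_bounded_series_le u C l :
  (forall N, \sum_(0 <= n < N) `|u n| <= C) -> series u @ \oo --> l -> `|l| <= C.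
Proof.
move=> uC ul; have nul : (fun N => `|series u N|) @ \oo --> `|l| by exact: cvg_norm.
rewrite -(cvg_lim _ nul)//.
apply: limr_le; first by apply/cvg_ex; exists `|l|.
by apply: nearW => N; rewrite (le_trans (ler_norm_sum _ _ _)).
Qed.

Lemma sum_triangle (F : nat -> nat -> R) N :
  \sum_(0 <= n < N) \sum_(0 <= i < n.+1) F i (n - i)%N =
  \sum_(0 <= i < N) \sum_(0 <= j < N - i) F i j.
Proof.
elim: N => [|N IH]; first by rewrite !big_nil.
rewrite big_nat_recr//= IH.
transitivity (\sum_(0 <= i < N.+1) (\sum_(0 <= j < N - i) F i j + F i (N - i)%N)).
  by rewrite big_split/= [in RHS]big_nat_recr//= subnn [X in _ + X + _]big_geq// addr0.
by apply: eq_big_nat => i /andP[_ iN]; rewrite subSn// big_nat_recr.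
Qed.

Lemma cauchy_product_le u v A B N :
  (forall N, \sum_(0 <= n < N) `|u n| <= A) ->
  (forall N, \sum_(0 <= n < N) `|v n| <= B) ->
  \sum_(0 <= n < N) \sum_(0 <= i < n.+1) `|u i| * `|v (n - i)%N| <= A * B.
Proof.
move=> uA vB; rewrite (sum_triangle (fun i j => `|u i| * `|v j|)).
apply: (@le_trans _ _ (\sum_(0 <= i < N) `|u i| * B)).
  by apply: ler_sum => i _; rewrite -mulr_sumr ler_wpM2l.
by rewrite -mulr_suml ler_wpM2r// (le_trans _ (vB 0%N))// big_nil.
Qed.

(** The partial sums of the Cauchy product run over a triangle. What is missing to
    the square of size N is bounded by the same corner for the absolute values,
    which tends to 0 because the triangle of size 2N contains that square. *)
Lemma cauchy_product_cvg u v A B lu lv :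
  (forall N, \sum_(0 <= n < N) `|u n| <= A) ->
  (forall N, \sum_(0 <= n < N) `|v n| <= B) ->
  series u @ \oo --> lu -> series v @ \oo --> lv ->
  series (fun n => \sum_(0 <= i < n.+1) u i * v (n - i)%N) @ \oo --> lu * lv.
Proof.
move=> uA vB ulu vlv.
pose U := series (fun n => `|u n|); pose V := series (fun n => `|v n|).
pose W := series (fun n => \sum_(0 <= i < n.+1) `|u i| * `|v (n - i)%N|).
have cU : cvgn U by apply: (@abs_bounded_series_cvg _ A) => N; under eq_bigr do rewrite normr_id.
have cV : cvgn V by apply: (@abs_bounded_series_cvg _ B) => N; under eq_bigr do rewrite normr_id.
have W0 n : 0 <= \sum_(0 <= i < n.+1) `|u i| * `|v (n - i)%N|.
  by apply: sumr_ge0 => i _; rewrite mulr_ge0.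
have cW : cvgn W.
  apply: (@abs_bounded_series_cvg _ (A * B)) => N.
  by under eq_bigr do rewrite ger0_norm//; exact: cauchy_product_le.
have WUV N : W N <= U N * V N.
  rewrite /W /series/= (sum_triangle (fun i j => `|u i| * `|v j|)).
  rewrite mulr_suml; apply: ler_sum_nat => i _; rewrite -mulr_sumr ler_wpM2l//.
  by rewrite [leRHS](@big_cat_nat _ _ _ (N - i))// ?leq_subr//= lerDl sumr_ge0.
have UVW N : U N * V N <= W (2 * N)%N.
  rewrite /W /series/= (sum_triangle (fun i j => `|u i| * `|v j|)).
  rewrite [leRHS](@big_cat_nat _ _ _ N)//=; last by rewrite mul2n -addnn leq_addr.
  apply: (@le_trans _ _ (\sum_(0 <= i < N) \sum_(0 <= j < 2 * N - i) `|u i| * `|v j|)).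
    rewrite mulr_suml; apply: ler_sum_nat => i iN; rewrite -mulr_sumr ler_wpM2l//.
    by rewrite [leRHS](@big_cat_nat _ _ _ N)//= ?lerDl ?sumr_ge0//; lia.
  by rewrite lerDl; apply: sumr_ge0 => i _; apply: sumr_ge0 => j _; rewrite mulr_ge0.
have UVWl : limn (fun N => U N * V N) = limn W.
  have cUV : cvgn (fun N => U N * V N) by apply: is_cvgM.
  apply/eqP; rewrite eq_le; apply/andP; split; last first.
    by apply: ler_lim => //; apply: nearW.
  have W2 : W (2 * n)%N @[n --> \oo] --> limn W.
    by apply: (@cvg_comp _ _ _ (muln 2) W); [exact: cvg_mulnl|exact: cW].
  rewrite -(cvg_lim _ W2)//; apply: ler_lim => //; last exact: nearW.
  by apply/cvg_ex; exists (limn W).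
have z0 : (fun N => U N * V N - W N) @ \oo --> (0 : R).
  rewrite -(subrr (limn W)) -{1}UVWl; apply: cvgB => //; exact: is_cvgM.
have : (fun N => series u N * series v N - series (fun n => \sum_(0 <= i < n.+1) u i * v (n - i)%N) N) @ \oo --> (0 : R).
  apply/cvgr0Pnorm_lt => e e0; move/cvgr0Pnorm_lt : z0 => /(_ e e0); apply: filterS => N.
  apply: le_lt_trans; rewrite [leRHS]ger0_norm ?subr_ge0//.
  rewrite /W /U /V /series/= (sum_triangle (fun i j => `|u i| * `|v j|)).
  rewrite (sum_triangle (fun i j => u i * v j)) !mulr_suml -!sumrB.
  apply: le_trans (ler_norm_sum _ _ _) _; apply: ler_sum_nat => i _.
  rewrite -!mulr_sumr -!mulrBr normrM ler_wpM2l//.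
  have sp (G : nat -> R) : \sum_(0 <= j < N) G j - \sum_(0 <= j < N - i) G j =
      \sum_(N - i <= j < N) G j.
    by rewrite (@big_cat_nat _ _ _ (N - i))/= ?leq_subr// addrAC subrr add0r.
  by rewrite !sp ler_norm_sum.
move=> h.
have -> : series (fun n => \sum_(0 <= i < n.+1) u i * v (n - i)%N) =
  (fun N => series u N * series v N - (series u N * series v N - series (fun n => \sum_(0 <= i < n.+1) u i * v (n - i)%N) N)).
  by apply/funext => N; rewrite opprB addrC subrK.
rewrite -[lu * lv]subr0; apply: cvgB => //; exact: cvgM.
Qed.

End Series.

Section PowerSeries.
Variable R : realType.
Implicit Types (a b : nat -> R) (A B C r x : R).

(** Absolute convergence in the closed disc of radius r, recorded through the bound
    that the partial sums satisfy. *)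
Definition psum_bounded a r C :=
  forall N, \sum_(0 <= n < N) `|a n| * r ^+ n <= C.

Lemma psum_bounded_at a r C x : psum_bounded a r C -> `|x| <= r ->
  forall N, \sum_(0 <= n < N) `|a n * x ^+ n| <= C.
Proof.
move=> aC xr N; apply: le_trans (aC N); apply: ler_sum => n _.
by rewrite normrM normrX ler_wpM2l// lerXn2r// nnegrE (le_trans _ xr).
Qed.

Lemma psum_bounded_cvg a r C x : psum_bounded a r C -> `|x| <= r ->
  cvgn (pseries a x).
Proof. by move=> aC xr; apply: abs_bounded_series_cvg; exact: psum_bounded_at aC xr. Qed.

Lemma psum_bounded_le a r r' C : 0 <= r' -> r' <= r -> psum_bounded a r C ->
  psum_bounded a r' C.
Proof.
move=> r0 rr aC N; apply: le_trans (aC N); apply: ler_sum => n _.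
by rewrite ler_wpM2l// lerXn2r// nnegrE// (le_trans r0).
Qed.

(** For r' < r the sequence n (r' / r)^n is bounded: shrinking the radius absorbs the
    factor brought by the derivative. *)
Lemma psum_bounded_diffs a r r' C : 0 < r' -> r' < r -> psum_bounded a r C ->
  exists C', psum_bounded (pseries_diffs a) r' C'.
Proof.
move=> r0 rr aC; pose s := r / r' - 1.
have s0 : 0 < s by rewrite subr_gt0 ltr_pdivlMr// mul1r.
have ns n : n%:R * r' ^+ n <= r ^+ n / s.
  have -> : r = r' * (1 + s) by rewrite /s addrC subrK mulrC divfK// gt_eqF.
  rewrite exprMn mulrC -mulrA ler_wpM2l ?exprn_ge0// ?(ltW r0)//.
  rewrite ler_pdivlMr//; elim: n => [|n IH]; first by rewrite mul0r expr0.
  have h : 1 <= (1 + s) ^+ n by rewrite exprn_ege1// lerDl ltW.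
  rewrite exprS mulrDl mul1r -natr1 mulrDl mul1r lerD//.
  by rewrite ler_peMr// ltW.
exists (C / s / r') => N.
apply: (@le_trans _ _ ((\sum_(0 <= n < N.+1) `|a n| * r ^+ n) / s / r')); last first.
  by rewrite !ler_pM2r ?invr_gt0.
rewrite -!mulrA mulr_suml big_nat_recl//= [leRHS]addrC ler_wpDr//.
  by rewrite !mulr_ge0// ?invr_ge0 ?exprn_ge0// ?divr_ge0// ltW// (lt_trans r0).
apply: ler_sum => n _; rewrite /pseries_diffs normrM normr_nat mulrAC mulrC.
rewrite -mulrA ler_wpM2l// mulrA ler_pdivlMr// -mulrA -exprSr.
exact: ns.
Qed.

Lemma is_derive_psum a r C x : psum_bounded a r C -> `|x| < r ->
  is_derive x (1 : R) (fun y => limn (pseries a y)) (limn (pseries (pseries_diffs a) x)).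
Proof.
move=> aC xr.
pose r1 := (`|x| + r) / 2; pose r2 := (r1 + r) / 2; pose r3 := (`|x| + r1) / 2.
have x0 := normr_ge0 x.
have [xr3 r31 r12 r2r] : [/\ `|x| < r3, r3 < r1, r1 < r2 & r2 < r].
  by rewrite /r3 /r2 /r1; split; lra.
have r10 : 0 < r1 by lra.
have r30 : 0 < r3 by lra.
have [C1 aC1] := psum_bounded_diffs r10 (lt_trans r12 r2r) aC.
have [C2 aC2] := psum_bounded_diffs r30 r31 aC1.
have nr3 : `|r3| = r3 by rewrite gtr0_norm.
apply: (@pseries_snd_diffs _ a r3) => //; last by rewrite nr3.
- by apply: psum_bounded_cvg aC _; rewrite nr3; lra.
- by apply: psum_bounded_cvg aC1 _; rewrite nr3; lra.
- by apply: psum_bounded_cvg aC2 _; rewrite nr3; lra.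
Qed.

Lemma psum_bounded_shift a r C : 0 < r -> psum_bounded a r C ->
  psum_bounded (fun n => a n.+1) r (C / r).
Proof.
move=> r0 aC N; rewrite ler_pdivlMr// mulr_suml; apply: le_trans (aC N.+1).
rewrite [leRHS]big_nat_recl//=; apply: ler_wpDl; first by rewrite expr0 mulr1.
by apply: ler_sum => n _; rewrite -mulrA exprSr.
Qed.

Lemma psumS a r C x : 0 < r -> psum_bounded a r C -> `|x| <= r ->
  limn (pseries a x) = a 0%N + x * limn (pseries (fun n => a n.+1) x).
Proof.
move=> r0 aC xr; apply: cvg_lim => //; rewrite -cvg_shiftS.
have c1 := psum_bounded_cvg (psum_bounded_shift r0 aC) xr.
rewrite (_ : (fun n => _) = (fun n => a 0%N + x * pseries (fun n => a n.+1) x n)); last first.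
  apply/funext => n; rewrite /pseries /series/= big_nat_recl//= expr0 mulr1.
  by congr (_ + _); rewrite mulr_sumr; apply: eq_bigr => i _; rewrite exprS mulrCA.
by apply: cvgD; [exact: cvg_cst|apply: cvgM; [exact: cvg_cst|exact: c1]].
Qed.

(** Dividing by x and letting x tend to 0 from the left kills the coefficients one
    after the other. *)
Lemma psum_eq0 a r C eta : 0 < r -> 0 < eta -> psum_bounded a r C ->
  (forall x, - eta < x < 0 -> `|x| <= r -> limn (pseries a x) = 0) ->
  forall n, a n = 0.
Proof.
move=> r0 eta0 + + n.
have IH0 : forall a C, psum_bounded a r C ->
    (forall x, - eta < x < 0 -> `|x| <= r -> limn (pseries a x) = 0) -> a 0%N = 0.
  move=> {}a {}C aC ax0; pose C1 := C / r.
  have aC1 := psum_bounded_shift r0 aC; rewrite -/C1 in aC1.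
  have C10 : 0 <= C1 by have := aC1 0%N; rewrite big_nil.
  apply/eqP; rewrite -normr_le0 leNgt; apply/negP => a0.
  pose x := - (Num.min (Num.min r (eta / 2)) (`|a 0%N| / (2 * (C1 + 1)))).
  have m0 : 0 < - x.
    by rewrite /x opprK !lt_min r0 !divr_gt0//= mulr_gt0//; lra.
  have [mr me ma] : [/\ - x <= r, - x <= eta / 2 & - x <= `|a 0%N| / (2 * (C1 + 1))].
    by rewrite /x opprK !ge_min !lexx/= !orbT; split.
  have nx : `|x| = - x by rewrite ltr0_norm//; lra.
  have xr : `|x| <= r by rewrite nx.
  have := ax0 x _ xr; rewrite (psumS r0 aC xr) => /(_ _)/eqP.
  have -> : - eta < x < 0 by apply/andP; split; lra.
  move=> /(_ isT); rewrite addr_eq0 => /eqP a0E.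
  have l1 := abs_bounded_series_le (psum_bounded_at aC1 xr) (psum_bounded_cvg aC1 xr).
  have : `|a 0%N| <= - x * C1.
    by rewrite a0E normrN normrM nx ler_wpM2l// ltW.
  apply/negP; rewrite -ltNge; apply: (@le_lt_trans _ _ (`|a 0%N| / (2 * (C1 + 1)) * C1)).
    by rewrite ler_wpM2r.
  rewrite mulrAC ltr_pdivrMr; last by rewrite mulr_gt0//; lra.
  by rewrite ltr_pM2l//; lra.
elim: n a C => [|n IH] a C; first exact: IH0.
move=> aC ax0; have a00 : a 0%N = 0 by exact: IH0 aC ax0.
apply: (IH (fun n => a n.+1) _ (psum_bounded_shift r0 aC)) => x xe xr.
have := ax0 x xe xr; rewrite (psumS r0 aC xr) a00 add0r => /eqP.
by rewrite mulf_eq0 => /orP[/eqP x0|/eqP //]; move: xe; rewrite x0 ltxx andbF.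
Qed.

(** Let y and h be the two sums. Differentiating y = e^h gives y' = h' y on the left
    of 0; this is an equality between power series, so it holds in the whole disc,
    and there y e^{-h} is constant. This avoids expanding e^h. *)
Lemma psum_exp_continuation a b r Ca Cb eta : 0 < r -> 0 < eta ->
  psum_bounded a r Ca -> psum_bounded b r Cb ->
  (forall x, - eta < x <= 0 -> `|x| < r ->
     limn (pseries a x) = expR (limn (pseries b x))) ->
  forall x, `|x| < r -> limn (pseries a x) = expR (limn (pseries b x)).
Proof.
move=> r0 eta0 aC bC ab x xr.
pose r1 := (`|x| + r) / 2.
have x0 := normr_ge0 x.
have [r10 xr1 r1r] : [/\ 0 < r1, `|x| < r1 & r1 < r] by rewrite /r1; split; lra.
have [C1 da] := psum_bounded_diffs r10 r1r aC.
have [C2 db] := psum_bounded_diffs r10 r1r bC.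
have aC1 := psum_bounded_le (ltW r10) (ltW r1r) aC.
pose y z := limn (pseries a z); pose h z := limn (pseries b z).
pose y' z := limn (pseries (pseries_diffs a) z).
pose h' z := limn (pseries (pseries_diffs b) z).
have dy z : `|z| < r -> is_derive z (1 : R) y (y' z) by exact: is_derive_psum aC.
have dh z : `|z| < r -> is_derive z (1 : R) h (h' z) by exact: is_derive_psum bC.
(* the coefficients of h' y - y' *)
pose c n := \sum_(0 <= i < n.+1) pseries_diffs b i * a (n - i)%N - pseries_diffs a n.
have cC : psum_bounded c r1 (C2 * Ca + C1).
  move=> N; apply: (@le_trans _ _ (\sum_(0 <= n < N) ((\sum_(0 <= i < n.+1)
     `|pseries_diffs b i * r1 ^+ i| * `|a (n - i)%N * r1 ^+ (n - i)|) +
     `|pseries_diffs a n| * r1 ^+ n))).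
    apply: ler_sum => n _; apply: (@le_trans _ _ ((\sum_(0 <= i < n.+1)
     `|pseries_diffs b i * a (n - i)%N| + `|pseries_diffs a n|) * r1 ^+ n)).
      rewrite ler_wpM2r ?exprn_ge0// ?(ltW r10)//.
      by rewrite (le_trans (ler_normB _ _))// lerD2r ler_norm_sum.
    rewrite mulrDl lerD2r mulr_suml; apply: ler_sum_nat => i /andP[_ ni].
    by rewrite -normrM mulrACA -exprD subnKC// !normrM normrX (gtr0_norm r10).
  rewrite big_split/= lerD//;
  apply: (@cauchy_product_le _ (fun i => pseries_diffs b i * r1 ^+ i) (fun i => a i * r1 ^+ i)) => M.
    by apply: psum_bounded_at db _ M; rewrite gtr0_norm.
  by apply: psum_bounded_at aC1 _ M; rewrite gtr0_norm.
have cE z : `|z| <= r1 -> limn (pseries c z) = h' z * y z - y' z.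
  move=> zr; apply: cvg_lim => //.
  rewrite (_ : pseries c z = (fun N => series (fun n => \sum_(0 <= i < n.+1)
     (pseries_diffs b i * z ^+ i) * (a (n - i)%N * z ^+ (n - i))) N -
     pseries (pseries_diffs a) z N)); last first.
    apply/funext => N; rewrite /pseries /series/= -sumrB; apply: eq_bigr => n _.
    rewrite /c mulrBl mulr_suml; congr (_ - _); apply: eq_big_nat => i /andP[_ ni].
    by rewrite mulrACA -exprD subnKC.
  apply: cvgB; last exact: psum_bounded_cvg da zr.
  apply: (cauchy_product_cvg (psum_bounded_at db zr) (psum_bounded_at aC1 zr)).
    exact: psum_bounded_cvg db zr.
  exact: psum_bounded_cvg aC1 zr.
have c0 n : c n = 0.
  move: n; apply: (@psum_eq0 c r1 (C2 * Ca + C1) eta r10 eta0 cC) => z /andP[ez z0] zr1.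
  rewrite cE//; have zr : `|z| < r by rewrite (le_lt_trans zr1).
  have nr : \forall t \near z, `|t| < r.
    exact: (@cvgr_norm_lt _ R^o R (nbhs z) _ id z cvg_id _ zr).
  have yE : \forall t \near z, y t = expR (h t).
    near=> t; apply: ab; last by near: t.
    apply/andP; split; first by near: t; exact: lt_nbhsr.
    by apply: ltW; near: t; exact: lt_nbhsl.
  have dzh := dh z zr; have dzy := dy z zr.
  have dE : is_derive z (1 : R) (expR \o h) (h' z * expR (h z)).
    rewrite mulrC; have dx : is_derive (h z) (1 : R) expR (expR (h z)) by exact: is_derive_expR.
    exact: is_derive1_comp.
  have dE' : is_derive z (1 : R) y (h' z * expR (h z)).
    by apply: near_eq_is_derive dE; apply: filterS yE => t /= ->.
  have -> : y' z = h' z * expR (h z).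
    by rewrite -(@derive_val _ _ _ _ _ _ _ dzy) (@derive_val _ _ _ _ _ _ _ dE').
  by rewrite -(nbhs_singleton yE) subrr.
have ode z : `|z| <= r1 -> y' z = h' z * y z.
  move=> zr; apply/eqP; rewrite eq_sym -subr_eq0 -cE//; apply/eqP.
  apply: cvg_lim => //; rewrite (_ : pseries c z = fun=> 0); first exact: cvg_cst.
  by apply/funext => N; rewrite /pseries /series/= big1// => i _; rewrite c0 mul0r.
pose D z := y z * expR (- h z).
have dD z : `|z| <= r1 -> is_derive z (1 : R) D 0.
  move=> zr1; have zr : `|z| < r by rewrite (le_lt_trans zr1).
  have dzh := dh z zr; have dzy := dy z zr.
  have dE : is_derive z (1 : R) (fun t => expR (- h t)) (- h' z * expR (- h z)).
    rewrite mulrC; have dx : is_derive (- h z) (1 : R) expR (expR (- h z)) by exact: is_derive_expR.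
    have dn : is_derive z (1 : R) (- h) (- h' z) by exact: is_deriveN.
    by have := @is_derive1_comp _ expR (- h) z _ _ dx dn.
  have dM : is_derive z (1 : R) D (y z *: (- h' z * expR (- h z)) + expR (- h z) *: y' z).
    exact: is_deriveM.
  suff <- : y z *: (- h' z * expR (- h z)) + expR (- h z) *: y' z = 0 by [].
  by rewrite (ode z zr1) /GRing.scale/=; ring.
have DE : D x = D 0.
  have cD z : `|z| <= r1 -> {for z, continuous D}.
    by move=> /dD dDz; apply/differentiable_continuous/derivable1_diffP.
  have H p q : p <= q -> (forall z, p <= z <= q -> `|z| <= r1) -> D q = D p.
    move=> pq pqr; have [||w _] := @MVT_segment _ D (fun=> 0) p q pq.
    - by move=> z; rewrite in_itv/= => /andP[pz zq]; apply: dD; apply: pqr; rewrite !ltW.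
    - by apply: continuous_in_subspaceT => z; rewrite inE/= in_itv/= => /pqr; exact: cD.
    - by rewrite mul0r => /eqP; rewrite subr_eq0 => /eqP.
  have [x_ge0|x_lt0] := leP 0 x.
    by apply: H => // z /andP[z0 zx]; rewrite ger0_norm// (le_trans zx)// (le_trans (ler_norm _))// ltW.
  apply/esym/H; first exact: ltW.
  move=> z /andP[xz z0]; rewrite ler0_norm// (le_trans _ (ltW xr1))// ltr0_norm//.
  by rewrite lerN2.
have D0 : D 0 = 1.
  by rewrite /D /y ab ?oppr_lt0 ?eta0 ?lexx ?normr0// -expRD subrr expR0.
by rewrite -[LHS]mulr1 -expR0 -(addNr (h x)) expRD mulrA -/(y x) -/(D x) DE D0 mul1r.
Unshelve. all: by end_near.
Qed.
End PowerSeries.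

(** * Polynomial approximation on the unit interval *)

Section Weierstrass.
Variable R : realType.
Implicit Types (phi psi : nat -> R) (y e : R).

(** The Bernstein polynomial of phi at y is the mean of phi at the endpoint of an
    n-step walk with success probability y; conditioning on the first step gives
    the recursion, from which the variance is read off without binomials. *)
Fixpoint bernstein n phi : {poly R} :=
  if n is n'.+1 then
    'X * bernstein n' (phi \o S) + (1 - 'X) * bernstein n' phi
  else (phi 0%N)%:P.

Lemma bernsteinS n phi y : (bernstein n.+1 phi).[y] =
  y * (bernstein n (phi \o S)).[y] + (1 - y) * (bernstein n phi).[y].
Proof. by rewrite /= !hornerE. Qed.

Lemma bernstein_affine n phi a b y :
  (bernstein n (fun k => a + b * phi k)).[y] = a + b * (bernstein n phi).[y].
Proof.
elim: n phi => [|n IH] phi; first by rewrite /= !hornerE.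
by rewrite !bernsteinS IH (IH (phi \o S)); ring.
Qed.

Lemma bernstein_le n phi psi y : 0 <= y <= 1 ->
  (forall k, (k <= n)%N -> phi k <= psi k) ->
  (bernstein n phi).[y] <= (bernstein n psi).[y].
Proof.
move=> y01; elim: n phi psi => [|n IH] phi psi h; first by rewrite /= !hornerE h.
have /andP[y0 y1] := y01; rewrite !bernsteinS lerD// ler_wpM2l ?subr_ge0//.
  by apply: IH => k kn; apply: h.
by apply: IH => k kn; apply: h; exact: leqW.
Qed.

Lemma bernstein_variance n c y :
  (bernstein n (fun k => (k%:R - c) ^+ 2)).[y] = (n%:R * y - c) ^+ 2 + n%:R * (y * (1 - y)).
Proof.
elim: n c => [|n IH] c; first by rewrite /= !hornerE; ring.
rewrite bernsteinS IH.
have -> : (fun k => (k%:R - c) ^+ 2) \o S = fun k => (k%:R - (c - 1)) ^+ 2 :> R.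
  by apply/funext => k /=; rewrite -natr1; ring.
by rewrite IH -natr1; ring.
Qed.

Lemma uniform_modulus (f : R -> R) (a b e : R) : continuous f -> 0 < e ->
  exists2 d : R, 0 < d & forall x y, a <= x <= b -> `|x - y| < d -> `|f x - f y| <= e.
Proof.
move=> cf e0.
pose P d x := forall y, `|x - y| < d -> `|f x - f y| <= e.
have : \forall d \near (0 : R)^'+, `[a, b]%classic `<=` P d.
  have /compact_near_coveringP cov := @segment_compact _ a b.
  apply: (cov R (0 : R)^'+ P) => x _; have e20 : 0 < e / 2 by rewrite divr_gt0.
  have /cvgrPdist_le/(_ _ e20)[d /= d0 hd] := cf x.
  exists (ball x (d / 2), `]0, d / 2[%classic) => /=.
    split; first by apply: nbhsx_ballx; rewrite divr_gt0.
    near=> t; rewrite /= in_itv/=; apply/andP; split => //.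
    by near: t; apply: nbhs_right_lt; rewrite divr_gt0.
  move=> [x' d'] /= [xx' /[!in_itv]/= /andP[_ d'd]] y xy; rewrite /ball/= in xx'.
  have h1 : `|f x - f x'| <= e / 2 by apply: hd => /=; apply: lt_trans xx' _; lra.
  have h2 : `|f x - f y| <= e / 2.
    apply: hd => /=; rewrite -(subrKA x') (le_lt_trans (ler_normD _ _))//.
    by lra.
  by rewrite -(subrKA (f x)) (le_trans (ler_normD _ _))// distrC; lra.
move=> hP; have : \forall d \near (0 : R)^'+, 0 < d /\ `[a, b]%classic `<=` P d.
  by near=> d; split; [near: d; exact: nbhs_right_gt|near: d].
move=> /filter_ex[d [d0 hd]]; exists d => // x y xab; apply: (hd x).
by rewrite /= in_itv.
Unshelve. all: by end_near.
Qed.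

(** The mean of the quadratic modulus of continuity at the endpoint of the walk,
    divided by n, is a variance of order 1/n. *)
Lemma weierstrass (f : R -> R) (e : R) : continuous f -> 0 < e ->
  exists p : {poly R}, forall y, 0 <= y <= 1 -> `|f y - p.[y]| <= e.
Proof.
move=> cf e0; have e20 : 0 < e / 2 by rewrite divr_gt0.
have [d d0 hd] := @uniform_modulus f 0 1 (e / 2) cf e20.
have [M M0 hM] : exists2 M : R, 0 <= M & forall y, 0 <= y <= 1 -> `|f y| <= M.
  have [||c _ hc] := @EVT_max R (fun y => `|f y|) 0 1 => //.
    by apply: continuous_subspaceT => x; apply: cvg_norm; exact: cf.
  by exists `|f c| => // y y01; apply: hc; rewrite in_itv.
pose C := 2 * M / d ^+ 2.
have C0 : 0 <= C by rewrite divr_ge0 ?mulr_ge0 ?exprn_ge0// ltW.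
(* far points are controlled by the variance, near ones by the modulus *)
have modul (x y : R) : 0 <= x <= 1 -> 0 <= y <= 1 -> `|f x - f y| <= e / 2 + C * (x - y) ^+ 2.
  move=> x01 y01; have [xy|xy] := ltP `|x - y| d.
    by rewrite (le_trans (hd _ _ x01 xy))// lerDl mulr_ge0// sqr_ge0.
  rewrite ler_wpDl ?(ltW e20)//; apply: (@le_trans _ _ (2 * M)).
    by rewrite (le_trans (ler_normB _ _))// mulr2n mulrDl mul1r lerD// hM.
  rewrite /C -mulrA ler_peMr ?mulr_ge0// mulrC ler_pdivlMr ?exprn_gt0// mul1r.
  by rewrite -(real_normK (num_real (x - y))) lerXn2r// nnegrE// ltW.
pose n := (Num.truncn (2 * C / e)).+1.
have n0 : 0 < n%:R :> R by rewrite ltr0n.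
have nC : C / n%:R <= e / 2.
  have : 2 * C / e < n%:R by exact: truncnS_gt.
  by rewrite ltr_pdivrMr// ler_pdivrMr//; lra.
exists (bernstein n (fun k => f (k%:R / n%:R))) => y /andP[y0 y1].
have y01 : 0 <= y <= 1 by rewrite y0.
have kn k : (k <= n)%N -> 0 <= (k%:R / n%:R : R) <= 1.
  by move=> kn; rewrite divr_ge0// ler_pdivrMr// mul1r ler_nat.
pose v k : R := (k%:R - n%:R * y) ^+ 2.
have vE k : (k%:R / n%:R - y) ^+ 2 = v k / n%:R ^+ 2.
  by rewrite /v -expr_div_n mulrBl [n%:R * y]mulrC mulfK// gt_eqF.
have vB : C / n%:R ^+ 2 * (bernstein n v).[y] <= e / 2.
  rewrite bernstein_variance subrr expr0n/= add0r; apply: le_trans nC.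
  have -> : C / n%:R ^+ 2 * (n%:R * (y * (1 - y))) = C / n%:R * (y * (1 - y)).
    by field; exact: lt0r_neq0.
  by apply: ler_piMr; [rewrite divr_ge0// ltW|apply: mulr_ile1 => //; lra].
rewrite ler_norml; apply/andP; split.
  suff : (bernstein n (fun k => f (k%:R / n%:R))).[y] <= f y + e / 2 + C / n%:R ^+ 2 * (bernstein n v).[y] by lra.
  rewrite -bernstein_affine; apply: bernstein_le => // k /kn k01.
  have := modul _ _ k01 y01; rewrite ler_norml vE mulrA mulrAC => /andP[_]; lra.
suff : f y - e / 2 + (- (C / n%:R ^+ 2)) * (bernstein n v).[y] <= (bernstein n (fun k => f (k%:R / n%:R))).[y] by lra.
rewrite -bernstein_affine; apply: bernstein_le => // k /kn k01.
have := modul _ _ k01 y01; rewrite ler_norml vE mulrA mulrAC => /andP[]; lra.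
Qed.

End Weierstrass.

(** * Convolution with a measure on the half-line *)

Section BoundedMeasurable.
Variable R : realType.
Local Notation borel := (measurableTypeR R).
Implicit Types (f g : R -> R) (T M t : R) (k : {measure set borel -> \bar R}).

(** What a locally bounded function is on [0, T]. *)
Definition bdd_meas T f :=
  measurable_fun (`[0, T]%classic : set borel) (f : borel -> borel) /\
  exists M, forall x, 0 <= x <= T -> `|f x| <= M.

Lemma bdd_meas_le T T' f : T' <= T -> bdd_meas T f -> bdd_meas T' f.
Proof.
move=> TT [mf [M hM]]; split.
  apply: measurable_funS mf => // x /=; rewrite !in_itv/= => /andP[-> xT'].
  exact: le_trans TT.
by exists M => x /andP[x0 xT]; apply: hM; rewrite x0 (le_trans xT).
Qed.

Lemma loc_bounded_bdd_meas f : loc_bounded f <-> forall T, bdd_meas T f.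
Proof.
split=> [[mf bf] T|H].
  split; last exact: bf.
  by apply: measurable_funS mf => // x /=; rewrite !in_itv/= => /andP[->].
split; last by move=> T; have [] := H T.
have -> : `[0%R, +oo[%classic = \bigcup_n `[0, n%:R]%classic :> set R.
  apply/seteqP; split => x /=.
    rewrite in_itv/= andbT => x0; exists (Num.truncn x).+1 => //=.
    by rewrite in_itv/= x0 ltW// truncnS_gt.
  by move=> [n _] /=; rewrite !in_itv/= => /andP[->].
by apply/measurable_fun_bigcup => [n|n]; [exact: measurable_itv|have [] := H n%:R].
Qed.

Lemma bdd_meas_cst T c : bdd_meas T (fun=> c).
Proof. by split; [exact: measurable_cst|exists `|c|]. Qed.

Lemma bdd_measD T f g : bdd_meas T f -> bdd_meas T g -> bdd_meas T (fun x => f x + g x).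
Proof.
move=> [mf [M hM]] [mg [N hN]]; split; first exact: measurable_funD.
by exists (M + N) => x xT; rewrite (le_trans (ler_normD _ _))// lerD ?hM ?hN.
Qed.

Lemma bdd_measM T f g : bdd_meas T f -> bdd_meas T g -> bdd_meas T (fun x => f x * g x).
Proof.
move=> [mf [M hM]] [mg [N hN]]; split; first exact: measurable_funM.
by exists (M * N) => x xT; rewrite normrM ler_pM ?hM ?hN.
Qed.

Lemma bdd_measZ T c f : bdd_meas T f -> bdd_meas T (fun x => c * f x).
Proof. by apply: bdd_measM; exact: bdd_meas_cst. Qed.

Lemma bdd_measX T f n : bdd_meas T f -> bdd_meas T (fun x => f x ^+ n).
Proof.
move=> bf; elim: n => [|n IH]; first by under eq_fun do rewrite expr0; exact: bdd_meas_cst.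
by under eq_fun do rewrite exprS; exact: bdd_measM.
Qed.

Lemma bdd_meas_norm T f : bdd_meas T f -> bdd_meas T (fun x => `|f x|).
Proof.
move=> [mf [M hM]]; split; first exact: measurableT_comp.
by exists M => x xT; rewrite normr_id hM.
Qed.

Lemma bdd_meas_sum T (F : nat -> R -> R) (r : seq nat) : (forall n, bdd_meas T (F n)) ->
  bdd_meas T (fun x => \sum_(i <- r) F i x).
Proof.
move=> bF; elim: r => [|i r IH].
  by under eq_fun do rewrite big_nil; exact: bdd_meas_cst.
by under eq_fun do rewrite big_cons; exact: bdd_measD.
Qed.

Lemma bdd_meas_eq T f g : (forall x, 0 <= x <= T -> f x = g x) -> bdd_meas T f -> bdd_meas T g.
Proof.
move=> fg [mf [M hM]]; split.
  apply: eq_measurable_fun mf => x; rewrite inE/= in_itv/= => xT; exact: fg.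
by exists M => x xT; rewrite -fg// hM.
Qed.

Lemma bdd_meas_cvg T M (F : nat -> R -> R) f : (forall n, bdd_meas T (F n)) ->
  (forall n x, 0 <= x <= T -> `|F n x| <= M) ->
  (forall x, 0 <= x <= T -> (fun n => F n x) @ \oo --> f x) -> bdd_meas T f.
Proof.
move=> bF FM Ff; split.
  apply: (@measurable_fun_cvg _ _ _ _ F) => [n|x]; first by have [] := bF n.
  by rewrite /= in_itv/=; exact: Ff.
exists M => x xT.
have nul : (fun n => `|F n x|) @ \oo --> `|f x| by apply: cvg_norm; exact: Ff.
rewrite -(cvg_lim _ nul)//; apply: limr_le; first by apply/cvg_ex; exists `|f x|.
by apply: nearW => n; exact: FM.
Qed.

End BoundedMeasurable.

Lemma probability_bounded_integrable (R : realType) (m : probability (measurableTypeR R) R)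
    (D : set (measurableTypeR R)) (f : measurableTypeR R -> R) (M : R) : measurable D ->
  measurable_fun D f -> (forall x, D x -> `|f x| <= M) -> m.-integrable D (EFin \o f).
Proof.
move=> mD mf fM; apply: measurable_bounded_integrable => //.
  by rewrite (le_lt_trans (probability_le1 _ _))// ltry.
by exists M; split; [exact: num_real|move=> x Mx s /fM fs; rewrite /= (le_trans fs)// ltW].
Qed.

Section Convol.
Variable R : realType.
Local Notation borel := (measurableTypeR R).
Variable k : {measure set borel -> \bar R}.
Implicit Types (f g : R -> R) (T M t : R).

Lemma convol_integrable t f : (k `[0%R, t]%classic < +oo)%E -> bdd_meas t f ->
  k.-integrable `[0, t] (EFin \o (fun s => f (t - s))).
Proof.
move=> kt [mf [M hM]]; apply: measurable_bounded_integrable => //.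
  apply: (@measurable_comp _ _ _ _ _ _ `[0, t]%classic f) => //.
    move=> _ [s /= + <-]; rewrite !in_itv/= => /andP[s0 st].
    by rewrite subr_ge0 st/= gerBl.
  exact: measurable_funB.
exists M; split; first exact: num_real.
move=> x Mx s /=; rewrite in_itv/= => /andP[s0 st]; rewrite (le_trans _ (ltW Mx))//.
by apply: hM; rewrite subr_ge0 st/= gerBl.
Qed.

Lemma eq_convol t f g : (forall s, 0 <= s <= t -> f s = g s) ->
  convol f k t = convol g k t.
Proof.
move=> fg; apply: eq_Rintegral => s; rewrite inE/= in_itv/= => /andP[s0 st].
by apply: fg; rewrite subr_ge0 st/= gerBl.
Qed.

Section FiniteMass.
Variable t : R.
Hypothesis kt : (k `[0%R, t]%classic < +oo)%E.

Lemma convolD f g : bdd_meas t f -> bdd_meas t g ->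
  convol (fun s => f s + g s) k t = convol f k t + convol g k t.
Proof. by move=> bf bg; rewrite /convol RintegralD//; exact: convol_integrable. Qed.

Lemma convolZ c f : bdd_meas t f -> convol (fun s => c * f s) k t = c * convol f k t.
Proof. by move=> bf; rewrite /convol RintegralZl//; exact: convol_integrable. Qed.

Lemma convolB f g : bdd_meas t f -> bdd_meas t g ->
  convol (fun s => f s - g s) k t = convol f k t - convol g k t.
Proof. by move=> bf bg; rewrite /convol RintegralB//; exact: convol_integrable. Qed.

Lemma convol_cst c : convol (fun=> c) k t = c * fine (k `[0, t]%classic).
Proof. by rewrite /convol Rintegral_cst. Qed.

Lemma convol_sum (F : nat -> R -> R) (r : seq nat) : (forall n, bdd_meas t (F n)) ->
  convol (fun s => \sum_(i <- r) F i s) k t = \sum_(i <- r) convol (F i) k t.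
Proof.
move=> bF; elim: r => [|i r IH].
  rewrite (@eq_convol _ _ (fun=> 0)); last by move=> s _; rewrite big_nil.
  by rewrite convol_cst mul0r big_nil.
rewrite (@eq_convol _ _ (fun s => F i s + \sum_(j <- r) F j s)); last first.
  by move=> s _; rewrite big_cons.
by rewrite convolD ?IH ?big_cons//; exact: bdd_meas_sum.
Qed.

Lemma le_convol f g : bdd_meas t f -> bdd_meas t g ->
  (forall s, 0 <= s <= t -> f s <= g s) -> convol f k t <= convol g k t.
Proof.
move=> bf bg fg; apply: le_Rintegral => //; [exact: convol_integrable..|].
move=> s /=; rewrite in_itv/= => /andP[s0 st].
by apply: fg; rewrite subr_ge0 st/= gerBl.
Qed.

Lemma norm_convol f : bdd_meas t f -> `|convol f k t| <= convol (fun s => `|f s|) k t.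
Proof. by move=> bf; apply: le_normr_Rintegral => //; exact: convol_integrable. Qed.

Lemma convol_bound f M : bdd_meas t f -> (forall s, 0 <= s <= t -> `|f s| <= M) ->
  `|convol f k t| <= M * fine (k `[0, t]%classic).
Proof.
move=> bf fM; rewrite (le_trans (norm_convol bf))// -convol_cst.
by apply: le_convol => //; [exact: bdd_meas_norm|exact: bdd_meas_cst].
Qed.

Lemma convol_cvg M (F : nat -> R -> R) f : (forall n, bdd_meas t (F n)) ->
  (forall n x, 0 <= x <= t -> `|F n x| <= M) ->
  (forall x, 0 <= x <= t -> (fun n => F n x) @ \oo --> f x) ->
  (fun n => convol (F n) k t) @ \oo --> convol f k t.
Proof.
move=> bF FM Ff; have bf := bdd_meas_cvg bF FM Ff.
have [| | | | | |If _ cf] := @dominated_convergence _ _ _ k `[0, t]%classic _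
   (fun n s => (F n (t - s))%:E) (fun s => (f (t - s))%:E) (fun=> M%:E).
- by [].
- by move=> n; have /integrableP[] := convol_integrable kt (bF n).
- by have /integrableP[] := convol_integrable kt bf.
- apply: aeW => s /=; rewrite in_itv/= => /andP[s0 st].
  apply: cvg_EFin; first exact: nearW.
  by apply: Ff; rewrite subr_ge0 st/= gerBl.
- by have := @convol_integrable t (fun=> M) kt (bdd_meas_cst _ _).
- apply: aeW => s n /=; rewrite in_itv/= => /andP[s0 st].
  by rewrite lee_fin FM// subr_ge0 st/= gerBl.
by apply: fine_cvg; rewrite fineK//; exact: integrable_fin_num.
Qed.

End FiniteMass.
End Convol.

Section Causal.
Variable R : realType.
Local Notation borel := (measurableTypeR R).
Implicit Types (f g phi : R -> R) (T M t : R).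

(** Extending by 0 to the negative half-line turns the convolution over [0, t] into
    an integral over a domain that does not depend on t. *)
Definition causal phi := continuous phi /\ forall x, x <= 0 -> phi x = 0.

Lemma causal_bound phi T : causal phi ->
  exists2 M, 0 <= M & forall x, x <= T -> `|phi x| <= M.
Proof.
move=> [cphi phi0]; have [T0|T0] := leP 0 T; last first.
  by exists 0 => // x xT; rewrite phi0 ?normr0// (le_trans xT)// ltW.
have [||c _ hc] := @EVT_max R (fun y => `|phi y|) 0 T => //.
  by apply: continuous_subspaceT => x; apply: cvg_norm; exact: cphi.
exists `|phi c| => // y yT; have [y0|y0] := leP y 0; first by rewrite phi0// normr0.
by apply: hc; rewrite in_itv/= yT ltW.
Qed.

Lemma causal_bdd_meas phi T : causal phi -> bdd_meas T phi.
Proof.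
move=> cp; split; first by apply: measurable_funTS; apply: continuous_measurable_fun; case: cp.
by have [M _ hM] := causal_bound T cp; exists M => x /andP[_]; exact: hM.
Qed.

Lemma causal_vanishing phi : causal phi -> continuous_vanishing0 phi.
Proof.
by move=> [cp p0]; split; [exact: continuous_subspaceT|exact: p0].
Qed.

Lemma causal0 : causal (fun=> 0).
Proof. by split => // x; exact: cvg_cst. Qed.

Lemma causalD f g : causal f -> causal g -> causal (fun x => f x + g x).
Proof.
move=> [cf f0] [cg g0]; split => [x|x x0]; last by rewrite f0// g0// addr0.
by apply: cvgD; [exact: cf|exact: cg].
Qed.

Lemma causalM f g : continuous f -> causal g -> causal (fun x => f x * g x).
Proof.
move=> cf [cg g0]; split => [x|x x0]; last by rewrite g0// mulr0.
by apply: cvgM; [exact: cf|exact: cg].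
Qed.

Lemma causalZ c g : causal g -> causal (fun x => c * g x).
Proof. by apply: causalM => x; exact: cvg_cst. Qed.

Lemma causal_sum (F : nat -> R -> R) (r : seq nat) : (forall n, causal (F n)) ->
  causal (fun x => \sum_(i <- r) F i x).
Proof.
move=> bF; elim: r => [|i r IH].
  by under eq_fun do rewrite big_nil; exact: causal0.
by under eq_fun do rewrite big_cons; exact: causalD.
Qed.

Lemma causal_extension f : continuous_vanishing0 f -> causal (fun x => f (Num.max x 0)).
Proof.
move=> [cf f0]; split; last by move=> x x0; rewrite max_r.
have cG : continuous (fun x : R => Num.max x 0).
  move=> x; apply: (@continuous_max _ _ (id : R -> R^o) (fun=> 0 : R^o)); first exact: cvg_id.
  by apply: cvg_cst; exact: nbhs_filter.
have G0 x : `[0, +oo[%classic (Num.max x 0 : R) by rewrite /= in_itv/= andbT le_max lexx orbT.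
move=> x; move/subspace_continuousP : cf => /(_ _ (G0 x)).
apply: cvg_comp => A /= wA.
by apply: (@filterS _ (nbhs x) _ _ _ _ (cG x _ wA)) => y /(_ (G0 y)).
Qed.

Lemma causal_truncation T f : 0 <= T -> causal f -> causal (fun x => f (Num.min x T)).
Proof.
move=> T0 [cf f0]; split; last by move=> x x0; rewrite f0// ge_min x0.
move=> x; apply: continuous_comp; last exact: cf.
apply: (@continuous_min _ _ (id : R -> R^o) (fun=> T : R^o)); first exact: cvg_id.
by apply: cvg_cst; exact: nbhs_filter.
Qed.

Variable rho : probability borel R.

Lemma fine_rho_le1 (A : set borel) : measurable A -> fine (rho A) <= 1.
Proof.
move=> mA; rewrite -lee_fin fineK ?probability_le1//.
exact: fin_num_measure.
Qed.

Lemma rho_fin t : (rho `[0%R, t]%classic < +oo)%E.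
Proof. by rewrite (le_lt_trans (probability_le1 _ _))// ltry. Qed.

Lemma convol_rho_bound t f M : 0 <= M -> bdd_meas t f ->
  (forall s, 0 <= s <= t -> `|f s| <= M) -> `|convol f rho t| <= M.
Proof.
move=> M0 bf fM; apply: le_trans (convol_bound (rho_fin t) bf fM) _.
by rewrite ler_piMr// fine_rho_le1.
Qed.

Lemma convol_causalE phi t : causal phi ->
  convol phi rho t = \int[rho]_(s in `[0, +oo[) phi (t - s).
Proof.
move=> [_ phi0]; rewrite /convol.
have -> : `[0%R, t]%classic = `[0%R, +oo[%classic `&` `]-oo, t]%classic :> set R.
  apply/seteqP; split => x /=; rewrite !in_itv/= andbT; first by move=> /andP[].
    by move=> [-> ->].
rewrite Rintegral_mkcondr; apply: eq_Rintegral => s _; rewrite patchE.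
case: ifPn => //; rewrite notin_setE/= in_itv/= => /negP; rewrite -ltNge => ts.
by rewrite phi0// subr_le0 ltW.
Qed.

Lemma causal_convol phi : causal phi -> causal (convol phi rho).
Proof.
move=> cp; split; last first.
  move=> x; rewrite le_eqVlt => /predU1P[->|x0]; last first.
    by rewrite /convol set_itv_ge ?Rintegral_set0// -leNgt bnd_simp.
  apply/eqP; rewrite -normr_le0; apply: convol_rho_bound => //.
    exact: causal_bdd_meas.
  by move=> s /andP[_ s0]; rewrite (proj2 cp)// normr0.
have -> : convol phi rho = fun t => \int[rho]_(s in `[0, +oo[) phi (t - s).
  by apply/funext => t; exact: convol_causalE.
move=> t; have [M M0 hM] := causal_bound (t + 1) cp.
have mp (x : R) : measurable_fun setT ((fun s => phi (x - s)) : borel -> borel).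
  apply: (@measurableT_comp _ _ _ _ _ _ (phi : borel -> borel)).
    by apply: continuous_measurable_fun; case: cp.
  exact: measurable_funB.
have bd (x y : R) : x < t + 1 -> 0 <= y -> `|phi (x - y)| <= M.
  by move=> xt y0; apply: hM; lra.
have := @continuity_under_integral R _ _ rho (fun t s => phi (t - s)) `[0%R, +oo[%classic
  (measurable_itv _) (t - 1) (t + 1) _ _ (fun=> M) _ _.
apply; last by rewrite inE/= in_itv/=; apply/andP; split; lra.
- move=> x /=; rewrite in_itv/= => /andP[_ xt].
  apply: (@probability_bounded_integrable _ _ _ _ M) => //.
    by apply: measurable_funTS; exact: mp.
  by move=> y /=; rewrite in_itv/= andbT => y0; exact: bd.
- apply: aeW => y _ x _; apply: continuous_comp; last exact: (proj1 cp).
  by apply: cvgB; [exact: cvg_id|exact: cvg_cst].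
- by apply: (@probability_bounded_integrable _ _ _ _ M) => // y _; rewrite ger0_norm.
- move=> x /=; rewrite in_itv/= => /andP[_ xt]; apply: aeW => y /=.
  by rewrite in_itv/= andbT => y0; exact: bd.
Qed.

End Causal.

(** * Volterra equations with a Lipschitz nonlinearity *)

Section LaplaceKernel.
Variable R : realType.
Local Notation borel := (measurableTypeR R).
Implicit Types (m : probability borel R) (lam : R).

Lemma measurable_expRN lam (D : set borel) :
  measurable_fun D ((fun s => (expR (- (lam * s)))%:E) : borel -> \bar R).
Proof.
apply/measurable_EFinP; apply: measurable_funTS; apply: measurableT_comp => //.
by apply: measurable_funN; exact: measurable_funM.
Qed.

Lemma expRN_integrable m lam : 0 <= lam ->
  m.-integrable `[0%R, +oo[ (EFin \o (fun s => expR (- (lam * s)))).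
Proof.
move=> lam0; apply: (@probability_bounded_integrable _ _ _ _ 1) => //.
  by apply/measurable_EFinP; exact: measurable_expRN.
move=> s /=; rewrite in_itv/= andbT => s0.
by rewrite ger0_norm ?expR_ge0// -expR0 ler_expR oppr_le0 mulr_ge0.
Qed.

End LaplaceKernel.

Section Volterra.
Variable R : realType.
Local Notation borel := (measurableTypeR R).
Variable rho : probability borel R.
Hypothesis rho00 : rho [set 0] = 0%E.
Implicit Types (f g u phi : R -> R) (T M t B C beta : R).

(** The absence of an atom at 0 is essential: at s = 0 the integrand e^{-n s} does not
    tend to 0. *)
Lemma laplace_cvg0 : (fun n : nat => laplace rho n%:R) @ \oo --> (0 : R).
Proof.
have [| | | | | |_ _ cf] := @dominated_convergence _ _ _ rho `[0%R, +oo[%classic _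
   (fun n s => (expR (- (n%:R * s)))%:E) (fun=> 0%E) (fun=> 1%:E).
- by [].
- by move=> n; exact: measurable_expRN.
- exact: measurable_cst.
- exists [set 0]; split => //.
  move=> s /= H; apply: contrapT => s0; apply: H; rewrite in_itv/= andbT => s_ge0.
  have {}s0 : 0 < s by rewrite lt_neqAle s_ge0 andbT eq_sym; apply/eqP.
  apply: cvg_EFin; first exact: nearW.
  rewrite (_ : _ \o _ = fun n => (expR (- s)) ^+ n); last first.
    by apply/funext => n /=; rewrite -expRM_natl mulrN.
  by apply: cvg_expr; rewrite ger0_norm ?expR_ge0// -expR0 ltr_expR oppr_lt0.
- suff : rho.-integrable `[0%R, +oo[%classic (EFin \o (fun=> 1 : R)) by [].
  by apply: (@probability_bounded_integrable _ _ _ _ 1) => // s _; rewrite normr1.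
- apply: aeW => s n /=; rewrite in_itv/= andbT => s0.
  by rewrite lee_fin ger0_norm ?expR_ge0// -expR0 ler_expR oppr_le0 mulr_ge0.
rewrite integral0 in cf.
by have := fine_cvg cf; rewrite /=; apply.
Qed.

Lemma expR_bdd_meas beta T : bdd_meas T (fun s => expR (beta * s)).
Proof.
have c : continuous (fun s : R => expR (beta * s)).
  move=> x; apply: continuous_comp; last exact: continuous_expR.
  by apply: cvgM; [exact: cvg_cst|exact: cvg_id].
split; first by apply: measurable_funTS; apply: continuous_measurable_fun.
have [T0|T0] := leP 0 T; last first.
  by exists 0 => x /andP[x0 xT]; have := le_trans x0 xT; rewrite leNgt T0.
have [|d _ hd] := @EVT_max R (fun s => expR (beta * s)) 0 T T0.
  exact: continuous_subspaceT.
by exists (expR (beta * d)) => x xT; rewrite ger0_norm ?expR_ge0// hd// in_itv.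
Qed.

(** In the norm sup e^{-beta t} |u t|, convolution with rho has norm at most the
    Laplace transform of rho at beta, which is small for large beta. *)
Lemma exists_weight B : exists2 beta, 0 <= beta & forall t, 0 <= t ->
  B * convol (fun s => expR (beta * s)) rho t <= 2^-1 * expR (beta * t).
Proof.
have [B0|B0] := leP B 0.
  exists 0 => // t t0; apply: (@le_trans _ _ 0); last by rewrite mulr_ge0 ?expR_ge0.
  by rewrite mulr_le0_ge0//; apply: Rintegral_ge0 => s _; exact: expR_ge0.
have B20 : 0 < (2 * B)^-1 by rewrite invr_gt0 mulr_gt0.
move/cvgrPdist_lt/(_ _ B20) : laplace_cvg0 => [N _ /(_ N (leqnn _))/=].
rewrite sub0r normrN => lN; exists N%:R => // t t0.
rewrite -ler_pdivlMl// mulrA -invfM [B * 2]mulrC.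
have exp_int := expRN_integrable rho (ler0n R N).
have -> : convol (fun s => expR (N%:R * s)) rho t =
    expR (N%:R * t) * \int[rho]_(s in `[0, t]) expR (- (N%:R * s)).
  rewrite -RintegralZl//; last by apply: integrableS exp_int => //; exact: subset_itvl.
  by apply: eq_Rintegral => s _; rewrite mulrBr expRD.
rewrite [leRHS]mulrC ler_wpM2l ?expR_ge0//.
apply: le_trans (ltW lN); rewrite /laplace ger0_norm; last first.
  by apply: Rintegral_ge0 => s _; exact: expR_ge0.
have int_t : rho.-integrable `[0%R, t] (EFin \o (fun s => expR (- (N%:R * s)))).
  by apply: integrableS exp_int => //; exact: subset_itvl.
apply: fine_le; [exact: integrable_fin_num..|].
apply: ge0_subset_integral => //.
- by have /integrableP[] := exp_int.
- exact: subset_itvl.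
Qed.

(** Gronwall: beta is such that B times the convolution contracts by 1/2 in the norm
    sup e^{-beta t} |u t|. *)
Lemma volterra_bound B C T beta u : 0 <= B -> 0 <= C ->
  (forall t, 0 <= t ->
    B * convol (fun s => expR (beta * s)) rho t <= 2^-1 * expR (beta * t)) ->
  0 <= beta -> bdd_meas T u ->
  (forall t, 0 <= t <= T -> `|u t| <= C + B * convol (fun s => `|u s|) rho t) ->
  forall t, 0 <= t <= T -> `|u t| <= 2 * C * expR (beta * t).
Proof.
move=> B0 C0 hB beta0 bu hu t tT.
pose S := [set expR (- (beta * s)) * `|u s| | s in [set s | 0 <= s <= T]].
have [M hM] := proj2 bu.
have e1 s : 0 <= s -> expR (- (beta * s)) <= 1.
  by move=> s0; rewrite -expR0 ler_expR oppr_le0 mulr_ge0.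
have hS : has_sup S.
  split; first by exists (expR (- (beta * t)) * `|u t|), t.
  exists M => _ [s sT <-]; have /andP[s0 _] := sT.
  by rewrite (le_trans _ (hM _ sT))// ler_piMl// e1.
pose m := sup S.
have uS s : 0 <= s <= T -> `|u s| <= m * expR (beta * s).
  move=> sT; rewrite -ler_pdivrMr ?expR_gt0// -expRN mulrC.
  by apply: (sup_upper_bound hS); exists s.
have : m <= C + 2^-1 * m.
  apply: ge_sup; first by case: hS.
  move=> _ [s sT <-]; have /andP[s0 s1] := sT.
  have bus : bdd_meas s (fun s => `|u s|) by apply: bdd_meas_norm; exact: bdd_meas_le bu.
  have h1 : convol (fun s => `|u s|) rho s <= m * convol (fun s => expR (beta * s)) rho s.
    rewrite -(convolZ (rho_fin _ _))//; last exact: expR_bdd_meas.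
    apply: le_convol => //; [exact: rho_fin|by apply: bdd_measZ; exact: expR_bdd_meas|].
    by move=> x /andP[x0 xs]; apply: uS; rewrite x0 (le_trans xs).
  have m0 : 0 <= m.
    apply: (@le_trans _ _ (expR (- (beta * s)) * `|u s|)); first by rewrite mulr_ge0// expR_ge0.
    by apply: (sup_upper_bound hS); exists s.
  rewrite -ler_pdivlMl ?expR_gt0// -expRN opprK; apply: le_trans (hu _ sT) _.
  rewrite mulrDr lerD//; first by rewrite ler_peMl// -expR0 ler_expR mulr_ge0.
  apply: (@le_trans _ _ (B * (m * convol (fun s => expR (beta * s)) rho s))).
    by rewrite ler_wpM2l.
  by rewrite mulrCA [leRHS]mulrA [leRHS]mulrC ler_wpM2l// [leRHS]mulrC hB.
move=> mC; have m2 : m <= 2 * C by lra.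
by apply: le_trans (uS _ tT) _; rewrite ler_wpM2r ?expR_ge0.
Qed.

Lemma volterra_unique T a u : bdd_meas T a -> bdd_meas T u ->
  (forall t, 0 <= t <= T -> u t = convol (fun s => a s * u s) rho t) ->
  forall t, 0 <= t <= T -> u t = 0.
Proof.
move=> ba bu hu t tT; have [M hM] := proj2 ba.
have M0 : 0 <= `|M| by [].
have [beta beta0 hb] := exists_weight `|M|.
apply/eqP; rewrite -normr_le0.
have := @volterra_bound `|M| 0 T beta u M0 (lexx 0) hb beta0 bu _ t tT.
rewrite mulr0 mul0r; apply => s sT; rewrite add0r hu//.
have /andP[s0 s1] := sT.
have bus : bdd_meas s u by exact: bdd_meas_le bu.
have bas : bdd_meas s a by exact: bdd_meas_le ba.
rewrite (le_trans (norm_convol (rho_fin _ _) (bdd_measM bas bus)))//.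
rewrite -(convolZ (rho_fin _ _))//; last exact: bdd_meas_norm.
apply: le_convol => //; first exact: rho_fin.
- by apply: bdd_meas_norm; exact: bdd_measM.
- by apply: bdd_measZ; exact: bdd_meas_norm.
- move=> x /andP[x0 xs]; rewrite normrM ler_wpM2r//.
  by rewrite (le_trans _ (ler_norm _))// hM// x0 (le_trans xs).
Qed.

End Volterra.

Section Picard.
Variable R : realType.
Local Notation borel := (measurableTypeR R).
Variable rho : probability borel R.
Hypothesis rho00 : rho [set 0] = 0%E.
Implicit Types (f g u phi : R -> R) (T M t A B C beta : R).

Lemma geometric_limit (U : nat -> R) A : 
  (forall n, `|U n.+1 - U n| <= A * 2^-1 ^+ n) ->
  cvgn U /\ forall n, `|U n - limn U| <= 2 * A * 2^-1 ^+ n.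
Proof.
move=> hU; have A0 : 0 <= A by have := hU 0%N; rewrite expr0 mulr1; apply: le_trans.
have hm n m : `|U (n + m)%N - U n| <= 2 * A * (2^-1 ^+ n - 2^-1 ^+ (n + m)).
  elim: m => [|m IH]; first by rewrite addn0 !subrr normr0 mulr0.
  rewrite addnS -(subrKA (U (n + m)%N)); apply: le_trans (ler_normD _ _) _.
  apply: le_trans (lerD (hU _) IH) _; rewrite exprS; lra.
have pn n : 0 <= 2^-1 ^+ n :> R by rewrite exprn_ge0.
have cU : cvgn U.
  have -> : U = fun n => U 0%N + series (fun n => U n.+1 - U n) n.
    by apply/funext => n; rewrite /series/= telescope_sumr// addrC subrK.
  apply: is_cvgD; first exact: is_cvg_cst.
  apply: (@abs_bounded_series_cvg _ _ (2 * A)) => N.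
  apply: (@le_trans _ _ (2 * A * (1 - 2^-1 ^+ N))); last by rewrite ler_piMr ?mulr_ge0// gerBl.
  elim: N => [|N IH]; first by rewrite big_nil expr0 subrr mulr0.
  by rewrite big_nat_recr//=; apply: le_trans (lerD IH (hU _)) _; rewrite exprS; lra.
split => // n.
have c : (fun m => `|U (n + m)%N - U n|) @ \oo --> `|limn U - U n|.
  apply: cvg_norm; apply: cvgB; last exact: cvg_cst.
  rewrite (_ : (fun m => U (n + m)%N) = (fun m => U (m + n)%N)); last first.
    by apply/funext => m; rewrite addnC.
  by rewrite cvg_shiftn.
rewrite distrC -(cvg_lim _ c)//; apply: limr_le; first by apply/cvg_ex; eexists; exact: c.
apply: nearW => m; apply: le_trans (hm n m) _.
by rewrite ler_wpM2l ?mulr_ge0// gerBl.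
Qed.

(** Picard iteration. With the weight of exists_weight the increments are halved at
    each step, locally uniformly, so that the limit is still continuous. *)
Lemma volterra_exists (F : R -> R -> R) :
  (forall phi, causal phi -> causal (fun t => F t (phi t))) ->
  (forall T, exists2 B, 0 <= B & forall t x y, t <= T ->
     `|F t x - F t y| <= B * `|x - y|) ->
  exists2 u, causal u & forall t, u t = convol (fun s => F s (u s)) rho t.
Proof.
move=> cF lF.
pose U n := iter n (fun phi => convol (fun s => F s (phi s)) rho) (fun=> 0).
have UE n t : U n.+1 t = convol (fun s => F s (U n s)) rho t by [].
have cU n : causal (U n).
  by elim: n => [|n IH]; [exact: causal0|apply: causal_convol => //; exact: cF].
have bFU n T : bdd_meas T (fun s => F s (U n s)) by apply: causal_bdd_meas; exact: cF.
have dU T : exists A, forall n t, t <= T -> `|U n.+1 t - U n t| <= A * 2^-1 ^+ n.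
  have [B B0 hB] := lF T; have [beta beta0 hb] := exists_weight rho00 B.
  have [A A0 hA] := causal_bound T (cU 1%N).
  have step n t : 0 <= t <= T -> `|U n.+1 t - U n t| <= A * 2^-1 ^+ n * expR (beta * t).
    elim: n t => [|n IH] t /andP[t0 tT].
      rewrite expr0 mulr1 {2}/U/= subr0 (le_trans (hA _ tT))// ler_peMr//.
      by rewrite -expR0 ler_expR mulr_ge0.
    rewrite (UE n.+1) (UE n) -(convolB (rho_fin _ _))//.
    have bD : bdd_meas t (fun s => F s (U n.+1 s) - F s (U n s)).
      apply: bdd_measD => //; apply: (bdd_meas_eq _ (bdd_measZ (-1) (bFU n t))).
      by move=> x _; rewrite mulN1r.
    apply: le_trans (norm_convol (rho_fin _ _) bD) _.
    apply: (@le_trans _ _ (convol (fun s => B * (A * 2^-1 ^+ n) * expR (beta * s)) rho t)).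
      apply: le_convol; first exact: rho_fin.
      - exact: bdd_meas_norm.
      - by apply: bdd_measZ; exact: expR_bdd_meas.
      - move=> s /andP[s0 st]; have sT : s <= T by rewrite (le_trans st).
        apply: le_trans (hB _ _ _ sT) _; rewrite -mulrA ler_wpM2l// IH//.
        by rewrite s0.
    rewrite (convolZ (rho_fin _ _))//; last exact: expR_bdd_meas.
    rewrite mulrAC mulrC exprS; apply: (@le_trans _ _ (A * 2^-1 ^+ n * (2^-1 * expR (beta * t)))).
      by rewrite ler_wpM2l ?hb// mulr_ge0// exprn_ge0.
    by rewrite le_eqVlt; apply/orP; left; apply/eqP; ring.
  exists (A * expR (beta * T)) => n t tT; have [t0|t0] := leP t 0.
    rewrite (proj2 (cU n.+1))// (proj2 (cU n))// subrr normr0.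
    by rewrite !mulr_ge0 ?expR_ge0// exprn_ge0.
  have tT' : 0 <= t <= T by rewrite ltW.
  apply: le_trans (step n t tT') _; rewrite mulrAC ler_wpM2r ?exprn_ge0//.
  by rewrite ler_wpM2l// ler_expR ler_wpM2l.
pose u t := limn (U ^~ t).
have hu T : exists A, forall n t, t <= T -> `|U n t - u t| <= A * 2^-1 ^+ n.
  have [A hA] := dU T; exists (2 * A) => n t tT.
  by apply: (proj2 (@geometric_limit (U ^~ t) A _)) => m; exact: hA.
have cUu t : (U ^~ t) @ \oo --> u t.
  have [A hA] := dU t; apply: (proj1 (@geometric_limit (U ^~ t) A _)) => m.
  exact: hA.
have cu : causal u.
  split => [t|t t0]; last first.
    apply: cvg_lim => //; rewrite (_ : (fun n => _) = fun=> 0); first exact: cvg_cst.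
    by apply/funext => n; rewrite (proj2 (cU n)).
  have [A hA] := hu (t + 1).
  apply/cvgrPdist_le => e e0; have e30 : 0 < e / 3 by rewrite divr_gt0.
  have : (fun n => A * 2^-1 ^+ n) @ \oo --> (0 : R).
    rewrite -(mulr0 A); apply: cvgM; first exact: cvg_cst.
    by apply: cvg_expr; rewrite ger0_norm// invf_lt1// ltr1n.
  move/cvgrPdist_le/(_ _ e30) => [n _ /(_ n (leqnn n))/=]; rewrite sub0r normrN => An.
  have := proj1 (cU n) t; move/cvgrPdist_le/(_ _ e30) => hn.
  near=> x.
  have xt : x <= t + 1 by apply: ltW; near: x; apply: lt_nbhsl; rewrite ltrDl.
  have h1 := hA n x xt.
  have tt : t <= t + 1 by rewrite lerDl.
  have h2 := hA n t tt.
  have h3 : `|U n t - U n x| <= e / 3 by near: x.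
  have h4 := ler_norm (A * 2^-1 ^+ n).
  move: h1 h2 h3; rewrite !ler_norml => /andP[? ?] /andP[? ?] /andP[? ?].
  by apply/andP; split; lra.
exists u => // t.
have bFu : causal (fun s => F s (u s)) by exact: cF.
have h1 : (fun n => U n.+1 t) @ \oo --> u t by rewrite (cvg_shiftS (U ^~ t)); exact: cUu.
rewrite -(cvg_lim _ h1)//; apply: cvg_lim => //.
have [B B0 hB] := lF t; have [A hA] := hu t.
have [M M0 hM] := causal_bound t bFu.
apply: (@convol_cvg _ _ t (rho_fin _ _) (M + B * `|A|)) => //.
- move=> n x /andP[x0 xt].
  rewrite -(subrK (F x (u x)) (F x (U n x))) addrC (le_trans (ler_normD _ _))// lerD//.
    exact: hM.
  apply: le_trans (hB _ _ _ xt) _; rewrite ler_wpM2l//.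
  apply: le_trans (hA n x xt) _; apply: le_trans (ler_norm _) _.
  rewrite normrM ler_piMr// ger0_norm ?exprn_ge0// exprn_ile1// invf_le1//.
  by rewrite ler1n.
- move=> x /andP[x0 xt]; apply/cvgrPdist_le => e e0.
  have e1 : 0 < e / (B + 1) by rewrite divr_gt0// ltr_wpDl.
  move/cvgrPdist_le : (cUu x) => /(_ _ e1); apply: filterS => n hn.
  apply: le_trans (hB _ _ _ xt) _.
  apply: (@le_trans _ _ (B * (e / (B + 1)))); first by rewrite ler_wpM2l.
  by rewrite mulrCA ler_piMr ?(ltW e0)// ler_pdivrMr ?ltr_wpDl// mul1r lerDl.
Unshelve. all: by end_near.
Qed.

End Picard.

(** * Infinite divisibility and the maximum principle *)

Section ConvolutionPowers.
Variable R : realType.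
Local Notation borel := (measurableTypeR R).
Implicit Types (m nu : probability borel R) (lam c : R).

Lemma measurable_shift (A : set borel) x : measurable A -> measurable [set y : borel | A (x + y)].
Proof.
move=> mA; have h : measurable_fun setT ((fun y => x + y) : borel -> borel).
  by apply: measurable_funD => //; exact: measurable_cst.
by have := h measurableT A mA; rewrite setTI.
Qed.

(** A convolution power is the law of a sum of independent variables, which makes it
    a measure with a multiplicative Laplace transform. The last clause, saying that
    mass on the open negative half-line never disappears, goes through the closed
    one because the power 0 is the Dirac mass at 0. *)
Lemma conv_power_measure m n : exists M : probability borel R,
  [/\ forall A, measurable A -> conv_power m n A = M A,
      forall lam c, (\int[m]_x (expR (- (lam * x)))%:E = c%:E)%E ->
        (\int[M]_x (expR (- (lam * x)))%:E = (c ^+ n)%:E)%E &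
      (0 < m `]-oo, 0%R[%classic)%E -> (0 < M `]-oo, 0%R]%classic)%E /\
        ((0 < n)%N -> (0 < M `]-oo, 0%R[%classic)%E)].
Proof.
elim: n => [|n [M [ME ML MN]]].
  exists (\d_ (0%R : borel) : probability borel R); split => //.
    by move=> lam c _; rewrite integral_dirac//= ?diracT ?mul1e ?mulr0 ?oppr0 ?expR0 ?expr0// ; exact: measurable_expRN.
  move=> _; split => //; rewrite /= diracE mem_set/= ?lte_fin//.
  by rewrite in_itv/=.
pose add (p : (borel * borel)%type) : borel := (p.1 + p.2)%R.
have madd : measurable_fun setT add by apply: measurable_funD; [exact: measurable_fst|exact: measurable_snd].
pose addm : {mfun (borel * borel)%type >-> borel} := HB.pack add (isMeasurableFun.Build _ _ _ _ _ madd).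
pose M' : probability borel R := distribution (m \x M)%E addm.
have M'E A : M' A = (\int[m]_x M [set y : R | A (x + y)%R])%E.
  apply: eq_integral => x _ /=; congr (M _).
  by apply/seteqP; split => y /=; rewrite /xsection/= inE.
exists M'; split.
- by move=> A mA; rewrite M'E/=; apply: eq_integral => x _; rewrite /= ME//; exact: measurable_shift.
- move=> lam c mc; rewrite ge0_integral_distribution//; last first.
  + exact: measurable_expRN.
  rewrite fubini_tonelli1//=; last first.
  + by apply: (@measurableT_comp _ _ _ _ _ _ ((fun s => (expR (- (lam * s)))%:E) : borel -> \bar R) _ add _ madd);
      exact: measurable_expRN.
  rewrite /fubini_F/=.
  under eq_integral.
    move=> x _; under eq_integral do rewrite /add/= mulrDr opprD expRD EFinM.
    rewrite ge0_integralZl//=; last exact: measurable_expRN.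
    rewrite (ML _ _ mc) muleC; over.
  rewrite /= ge0_integralZl//=; last 2 first.
  + exact: measurable_expRN.
  + have c0 : 0 <= c.
      by rewrite -lee_fin -mc; apply: integral_ge0 => x _; rewrite lee_fin expR_ge0.
    by rewrite lee_fin exprn_ge0.
  by rewrite mc -EFinM exprSr.
- move=> mN; have [M0 _] := MN mN.
  have M'N : (0 < M' `]-oo, 0%R[%classic)%E.
    apply: (@lt_le_trans _ _ ((m \x M) (`]-oo, 0%R[%classic `*` `]-oo, 0%R]%classic))%E).
      by rewrite product_measure1E//; exact: mule_gt0.
    apply: le_measure; rewrite ?inE//.
    + exact: measurableX.
    + by have := madd measurableT `]-oo, 0%R[%classic (measurable_itv _); rewrite setTI.
    + move=> [x y] /= []; rewrite !in_itv/= /add/= => x0 y0; lra.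
  split => //; apply: (lt_le_trans M'N); apply: le_measure; rewrite ?inE//.
  by move=> x /=; rewrite !in_itv/= => /ltW.
Qed.

Lemma laplaceE m lam : m `]-oo, 0%R[%classic = 0%E -> 0 <= lam ->
  (\int[m]_x (expR (- (lam * x)))%:E = (laplace m lam)%:E)%E.
Proof.
move=> m0 lam0; rewrite (ge0_negligible_integral _ _ _ _ m0)//; last exact: measurable_expRN.
have -> : [set: borel] `\` `]-oo, 0%R[%classic = `[0%R, +oo[%classic.
  by rewrite setTD setCitvl.
rewrite /laplace /Rintegral fineK//.
by apply: integrable_fin_num => //; exact: expRN_integrable.
Qed.

Lemma laplace_gt0 m lam : m `]-oo, 0%R[%classic = 0%E -> 0 <= lam -> 0 < laplace m lam.
Proof.
move=> m0 lam0; rewrite lt_neqAle Rintegral_ge0 ?andbT; last by move=> x _; exact: expR_ge0.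
apply/negP => /eqP l0; have := laplaceE m0 lam0; rewrite -l0 => i0.
have : (\int[m]_x `|(expR (- (lam * x)))%:E| = 0)%E.
  by under eq_integral do rewrite gee0_abs ?lee_fin ?expR_ge0//.
move/(ae_eq_integral_abs m measurableT (@measurable_expRN R lam setT)).1 => [N [mN N0 hN]].
have : m setT = 0%E.
  apply: (subset_measure0 _ mN _ N0) => // x _; apply: hN => /= /(_ I)/eqP.
  by rewrite eqe gt_eqF// expR_gt0.
by rewrite probability_setT => /eqP; rewrite onee_eq0.
Qed.

Lemma laplace_le1 m lam : m `]-oo, 0%R[%classic = 0%E -> 0 <= lam -> laplace m lam <= 1.
Proof.
move=> m0 lam0; rewrite -lee_fin -laplaceE//.
rewrite (ge0_negligible_integral _ _ _ _ m0)//; last exact: measurable_expRN.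
rewrite -(probability_setT m) -[leRHS]mul1e -integral_cst//.
rewrite [leRHS](ge0_negligible_integral _ _ _ _ m0)//.
apply: ge0_le_integral => //.
- exact: measurableD.
- exact: measurable_expRN.
- move=> x [_ /=]; rewrite in_itv/= => /negP; rewrite -leNgt => x0.
  by rewrite lee_fin -expR0 ler_expR oppr_le0 mulr_ge0.
Qed.

(** Were the root to charge the negative half-line, so would its power nu. *)
Lemma infinitely_divisible_root nu n : nu `]-oo, 0%R[%classic = 0%E ->
  infinitely_divisible nu -> (0 < n)%N ->
  exists2 m : probability borel R, m `]-oo, 0%R[%classic = 0%E &
    forall lam, 0 <= lam -> laplace m lam ^+ n = laplace nu lam.
Proof.
move=> nu0 + n0; move=> /(_ n n0)[m hm]; have [M [ME ML MN]] := conv_power_measure m n.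
have nuM A : measurable A -> nu A = M A by move=> mA; rewrite hm// ME.
have m0 : m `]-oo, 0%R[%classic = 0%E.
  apply/eqP; rewrite eq_le measure_ge0 andbT leNgt; apply/negP => /MN[_ /(_ n0)].
  by rewrite -nuM// nu0 ltxx.
exists m => // lam lam0.
have h := ML _ _ (laplaceE m0 lam0).
apply/EFin_inj; rewrite -h -laplaceE//.
by apply: eq_measure_integral => A mA _; exact/esym/nuM.
Qed.

End ConvolutionPowers.

Section MaximumPrinciple.
Variable R : realType.
Local Notation borel := (measurableTypeR R).
Variable rho : probability borel R.
Implicit Types (p q : {poly R}) (phi : R -> R) (m nu : probability borel R).

Lemma integrable_sum_EFin d (T : measurableType d) (mu : {measure set T -> \bar R})
    (D : set T) (I : Type) (r : seq I) (F : I -> T -> R) : measurable D ->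
  (forall i, mu.-integrable D (EFin \o F i)) ->
  mu.-integrable D (EFin \o (fun x => \sum_(i <- r) F i x)).
Proof.
move=> mD iF; rewrite (_ : _ \o _ = fun x => (\sum_(i <- r) (F i x)%:E)%E).
  by apply: integrable_sum => // j _; exact: iF.
by apply/funext => x /=; rewrite sumEFin.
Qed.

Lemma Rintegral_sum d (T : measurableType d) (mu : {measure set T -> \bar R})
    (D : set T) (I : Type) (r : seq I) (F : I -> T -> R) : measurable D ->
  (forall i, mu.-integrable D (EFin \o F i)) ->
  \int[mu]_(x in D) (\sum_(i <- r) F i x) = \sum_(i <- r) \int[mu]_(x in D) F i x.
Proof.
move=> mD iF; elim: r => [|i r IH].
  by rewrite big_nil; under eq_Rintegral do rewrite big_nil; rewrite Rintegral_cst// mul0r.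
rewrite big_cons -IH -RintegralD//; last exact: integrable_sum_EFin.
by apply: eq_Rintegral => x _; rewrite big_cons.
Qed.

Lemma expRN_monomial_integrable m c (i : nat) :
  m.-integrable `[0%R, +oo[ (EFin \o (fun s => c * expR (- (i%:R * s)))).
Proof. exact: (integrableZl _ _ (expRN_integrable _ (ler0n _ i))). Qed.

Lemma poly_expRN p y s :
  p.[y * expR (- s)] = \sum_(i < size p) (p`_i * y ^+ i) * expR (- (i%:R * s)).
Proof.
rewrite horner_coef; apply: eq_bigr => i _.
by rewrite exprMn -expRM_natl mulrN mulrA.
Qed.

Lemma poly_expRN_integrable m p y :
  m.-integrable `[0%R, +oo[ (EFin \o (fun s => p.[y * expR (- s)])).
Proof.
under [X in EFin \o X]eq_fun do rewrite poly_expRN.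
by apply: integrable_sum_EFin => // i; exact: expRN_monomial_integrable.
Qed.

Lemma poly_expRN_integral m p y :
  \int[m]_(s in `[0, +oo[) p.[y * expR (- s)] =
  \sum_(i < size p) (p`_i * y ^+ i) * laplace m i%:R.
Proof.
transitivity (\sum_(i < size p) \int[m]_(s in `[0, +oo[) ((p`_i * y ^+ i) * expR (- (i%:R * s)))); last first.
  by apply: eq_bigr => i _; rewrite RintegralZl//; exact: expRN_integrable.
under eq_Rintegral do rewrite poly_expRN.
by apply: Rintegral_sum => // i; exact: expRN_monomial_integrable.
Qed.

(** Convolution with rho multiplies e^{j t} by the Laplace transform of rho at j, so
    it acts in this way on p, seen as a function of e^t. *)
Definition laplace_poly p : {poly R} := \poly_(i < size p) (p`_i * laplace rho i%:R).

(** Write q for the convolution of p with rho, and nu_n for the n-th root of nu. At a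
    maximum y of q the integral of q(y) - q(y e^{-s}) against nu_n is nonnegative.
    Multiplied by n, it acts on the monomial of degree j through
    n (1 - e^{-psi_j / n}), which tends to psi_j, where psi = - ln of the Laplace
    transform of nu. As the Laplace transform of rho is 1 / (1 + psi), the limit is
    p(y) - q(y). *)
Lemma poly_max_principle p y : feller_kernel rho -> 0 <= y <= 1 ->
  (forall z, 0 <= z <= 1 -> (laplace_poly p).[z] <= (laplace_poly p).[y]) ->
  (laplace_poly p).[y] <= p.[y].
Proof.
move=> [_ _ [nu [nu0 idnu lapE]]] /andP[y0 y1] qmax.
pose q := laplace_poly p.
pose psi (j : nat) := - ln (laplace nu j%:R).
have psi0 j : 0 <= psi j by rewrite oppr_ge0 ln_le0// laplace_le1.
have expsi j : expR (- psi j) = laplace nu j%:R.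
  by rewrite opprK lnK// posrE laplace_gt0.
have qE (z : R) : q.[z] = \sum_(i < size p) p`_i * laplace rho i%:R * z ^+ i.
  by rewrite horner_poly.
have step n : 0 <= \sum_(i < size p) (p`_i * laplace rho i%:R * y ^+ i) *
    (n.+1%:R * (1 - expR (- psi i / n.+1%:R))).
  have [m m0 mlap] := infinitely_divisible_root nu0 idnu (ltn0Sn n).
  have mE (i : nat) : laplace m i%:R = expR (- psi i / n.+1%:R).
    apply: (@pexpIrn _ n.+1) => //; rewrite ?nnegrE ?expR_ge0 ?(ltW (laplace_gt0 _ _))//.
    by rewrite mlap// -expRM_natl mulrC divfK// expsi.
  have : \int[m]_(s in `[0, +oo[) q.[y * expR (- s)] <= \int[m]_(s in `[0, +oo[) q.[y].
    apply: le_Rintegral => //.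
    - exact: poly_expRN_integrable.
    - exact: (@probability_bounded_integrable _ _ _ _ `|q.[y]|).
    - move=> s /=; rewrite in_itv/= andbT => s0; apply: qmax.
      rewrite mulr_ge0 ?expR_ge0//= mulr_ile1 ?expR_ge0//.
      by rewrite -expR0 ler_expR oppr_le0.
  have mT : fine (m `[0%R, +oo[%classic) = 1.
    have -> : `[0%R, +oo[%classic = ~` `]-oo, 0%R[%classic :> set borel by rewrite setCitvl.
    by rewrite probability_setC// m0 sube0.
  rewrite Rintegral_cst// mT mulr1.
  pose qi (i : nat) := p`_i * laplace rho i%:R.
  have -> : \int[m]_(s in `[0, +oo[) q.[y * expR (- s)] =
      \sum_(i < size p) qi i * y ^+ i * laplace m i%:R.
    rewrite poly_expRN_integral.
    rewrite (big_ord_widen_cond (size p) xpredT (fun i => q`_i * y ^+ i * laplace m i%:R)); last exact: size_poly.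
    rewrite big_mkcond/=; apply: eq_bigr => i _; rewrite coef_poly ltn_ord.
    case: ifPn => // ; rewrite -leqNgt => /leq_sizeP/(_ i (leqnn _)).
    by rewrite coef_poly ltn_ord /qi => ->; rewrite !mul0r.
  rewrite qE -subr_ge0 -sumrB => h.
  rewrite (eq_bigr (fun i : 'I_(size p) => n.+1%:R * (qi i * y ^+ i - qi i * y ^+ i * laplace m i%:R))); last first.
    by move=> i _; rewrite mE /qi; ring.
  by rewrite -mulr_sumr mulr_ge0.
have lim : (fun n => \sum_(i < size p) (p`_i * laplace rho i%:R * y ^+ i) *
    (n.+1%:R * (1 - expR (- psi i / n.+1%:R)))) @ \oo -->
    \sum_(i < size p) (p`_i * laplace rho i%:R * y ^+ i) * psi i.
  apply: cvg_big => [|i _]; first exact: add_continuous.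
  apply: cvgM; first exact: cvg_cst.
  apply: (@squeeze_cvgr _ _ _ _ (fun n => psi i - psi i ^+ 2 * n.+1%:R^-1) (fun=> psi i)).
  - apply: nearW => n; have n0 : 0 < n.+1%:R :> R by rewrite ltr0n.
    set x := psi i / n.+1%:R; have x0 : 0 <= x by rewrite divr_ge0.
    have -> : psi i = n.+1%:R * x by rewrite mulrC divfK// gt_eqF.
    have -> : - (n.+1%:R * x) / n.+1%:R = - x by field; rewrite gt_eqF.
    have h1 : 1 - x <= expR (- x) by have := expR_ge1Dx (- x).
    have h2 : expR (- x) <= 1 - x + x ^+ 2.
      rewrite expRN; have h : 1 + x <= expR x by exact: expR_ge1Dx.
      apply: (@le_trans _ _ (1 + x)^-1); first by rewrite lef_pV2 ?posrE ?expR_gt0//; lra.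
      rewrite -[leLHS]mul1r ler_pdivrMr; last lra.
      have : 0 <= x ^+ 3 by rewrite exprn_ge0.
      by rewrite !exprS expr0; lra.
    apply/andP; split; last by rewrite ler_pM2l//; lra.
    have -> : n.+1%:R * x - (n.+1%:R * x) ^+ 2 / n.+1%:R = n.+1%:R * (x - x ^+ 2).
      by field; rewrite gt_eqF.
    by rewrite ler_pM2l//; lra.
  - rewrite -[X in _ --> X]subr0; apply: cvgB; first exact: cvg_cst.
    rewrite -(mulr0 (psi i ^+ 2)); apply: cvgM; first exact: cvg_cst.
    exact: cvg_harmonic.
  - exact: cvg_cst.
have : 0 <= \sum_(i < size p) (p`_i * laplace rho i%:R * y ^+ i) * psi i.
  rewrite -(cvg_lim _ lim)//; apply: limr_ge; first by apply/cvg_ex; eexists; exact: lim.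
  exact: nearW.
rewrite -/q qE [p.[y]]horner_coef.
suff -> : \sum_(i < size p) p`_i * y ^+ i =
    \sum_(i < size p) p`_i * laplace rho i%:R * y ^+ i +
    \sum_(i < size p) (p`_i * laplace rho i%:R * y ^+ i) * psi i by rewrite lerDl.
rewrite -big_split/=; apply: eq_bigr => i _.
have -> : laplace rho i%:R = 1 / (1 + psi i) by rewrite lapE.
have : 1 + psi i != 0 by rewrite gt_eqF// ltr_wpDr.
by move=> ?; field.
Qed.

End MaximumPrinciple.

Section CausalMaximum.
Variable R : realType.
Local Notation borel := (measurableTypeR R).
Variable rho : probability borel R.
Implicit Types (p q : {poly R}) (phi : R -> R).

(** As a function of y = e^{t - T}, phi extends continuously to [0, 1] and is therefore
    close to a polynomial, for which the principle is already known. *)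
Lemma causal_max_principle phi T e : feller_kernel rho -> causal phi -> 0 <= T -> 0 < e ->
  exists t, [/\ t <= T, forall s, s <= T -> convol phi rho s <= convol phi rho t + e &
    convol phi rho t <= phi t + e].
Proof.
move=> Frho cphi T0 e0; have [rho0 _ _] := Frho.
pose a := expR (- (T + 1)).
have a0 : 0 < a by exact: expR_gt0.
(* phi in the variable y = e^{t - T}, which ranges over [0, 1] *)
pose Phi y := phi (T + ln (Num.max y a)).
have cPhi : continuous Phi.
  move=> y; apply: continuous_comp; last exact: (proj1 cphi).
  apply: cvgD; first exact: cvg_cst.
  apply: continuous_comp; last by apply: continuous_ln; rewrite lt_max a0 orbT.
  apply: (@continuous_max _ _ (id : R -> R^o) (fun=> a : R^o)); first exact: cvg_id.
  by apply: cvg_cst; exact: nbhs_filter.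
have PhiE s : s <= T -> phi s = Phi (expR (s - T)).
  move=> sT; rewrite /Phi; have [s1|s1] := leP (- 1) s.
    rewrite max_l; last by rewrite ler_expR; lra.
    by rewrite expRK [T + _]addrC subrK.
  rewrite max_r; last by rewrite ler_expR; lra.
  rewrite expRK (proj2 cphi s); last lra.
  by rewrite (proj2 cphi)//; lra.
have Phi0 : Phi 0 = 0.
  by rewrite /Phi max_r ?(ltW a0)// expRK (proj2 cphi)//; lra.
have e40 : 0 < e / 4 by rewrite divr_gt0.
have [p pPhi] := weierstrass cPhi e40.
pose q := laplace_poly rho p.
have pphi s : s <= T -> `|phi s - p.[expR (s - T)]| <= e / 4.
  move=> sT; rewrite PhiE//; apply: pPhi; rewrite expR_ge0/=.
  by rewrite -expR0 ler_expR subr_le0.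
have ucq s : s <= T -> `|convol phi rho s - q.[expR (s - T)]| <= e / 4.
  move=> sT; rewrite (convol_causalE _ _ cphi).
  have -> : q.[expR (s - T)] = \int[rho]_(x in `[0, +oo[) p.[expR (s - T) * expR (- x)].
    rewrite poly_expRN_integral /q /laplace_poly horner_poly.
    by apply: eq_bigr => i _; rewrite mulrAC.
  have i1 := poly_expRN_integrable rho p (expR (s - T)).
  have [M M0 hM] := causal_bound s cphi.
  have i2 : rho.-integrable `[0%R, +oo[ (EFin \o (fun x => phi (s - x))).
    apply: (@probability_bounded_integrable _ _ _ _ M) => //.
      apply: measurable_funTS; apply: (@measurableT_comp _ _ _ _ _ _ (phi : borel -> borel)).
        by apply: continuous_measurable_fun; case: cphi.
      exact: measurable_funB.
    by move=> y /=; rewrite in_itv/= andbT => y0; apply: hM; lra.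
  have mI : measurable (`[0%R, +oo[%classic : set borel) by exact: measurable_itv.
  have i3 : rho.-integrable `[0%R, +oo[ (EFin \o (fun x => phi (s - x) - p.[expR (s - T) * expR (- x)])).
    by have := integrableB mI i2 i1.
  rewrite -RintegralB//; apply: le_trans (le_normr_Rintegral mI i3) _.
  apply: (@le_trans _ _ (\int[rho]_(x in `[0, +oo[) (e / 4))).
    apply: le_Rintegral => //; first by have := integrable_norm i3.
      by apply: (@probability_bounded_integrable _ _ _ _ (e / 4)) => // y _; rewrite gtr0_norm.
    move=> x /=; rewrite in_itv/= andbT => x0; rewrite -expRD.
    have -> : s - T + - x = (s - x) - T by ring.
    by apply: pphi; lra.
  by rewrite Rintegral_cst// ler_piMr ?(ltW e40)// fine_rho_le1.
have [||y y01 ymax] := @EVT_max R (horner q) 0 1 => //.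
  by apply: continuous_subspaceT => x; exact: continuous_horner.
rewrite in_itv/= in y01.
have qmax z : 0 <= z <= 1 -> q.[z] <= q.[y] by move=> z01; apply: ymax; rewrite in_itv.
have qp : q.[y] <= p.[y] by exact: poly_max_principle.
have sup_q s : s <= T -> convol phi rho s <= q.[y] + e / 4.
  move=> sT; have := ucq s sT; rewrite ler_norml => /andP[_].
  have : q.[expR (s - T)] <= q.[y].
    by apply: qmax; rewrite expR_ge0/= -expR0 ler_expR subr_le0.
  by lra.
(* a maximum at y = 0, that is at t = -oo, is replaced by one at t = 0 *)
have /andP[y0 y1] := y01; move: y0; rewrite le_eqVlt => /predU1P[y0|y0].
  have Up0 := proj2 (causal_convol rho cphi) 0 (lexx 0).
  exists 0; split => //; last by rewrite Up0 (proj2 cphi)// add0r ltW.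
  move=> s sT; have := sup_q s sT; have := pPhi y y01.
  rewrite -y0 Phi0 ler_norml Up0 -/q => /andP[+ _]; rewrite -y0 in qp; lra.
exists (T + ln y); have tT : T + ln y <= T by rewrite gerDl ln_le0.
have ey : expR (T + ln y - T) = y by rewrite addrAC subrr add0r lnK.
have := ucq _ tT; rewrite ey => h1; have := pphi _ tT; rewrite ey => h2.
move: h1 h2; rewrite !ler_norml => /andP[h1 h1'] /andP[h2 h2'].
split => //; last lra.
by move=> s sT; have := sup_q s sT; lra.
Qed.

End CausalMaximum.

(** * The quadratic equation *)

Section QuadraticVolterra.
Variable R : realType.
Local Notation borel := (measurableTypeR R).
Variable rho : probability borel R.
Implicit Types (g h a : R -> R).

Lemma continuous_maxr (u v : R -> R) : continuous u -> continuous v ->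
  continuous (fun x => Num.max (u x) (v x)).
Proof. by move=> cu cv x; apply: (@continuous_max _ _ (u : R -> R^o) (v : R -> R^o)); [exact: cu|exact: cv]. Qed.

Lemma continuous_minr (u v : R -> R) : continuous u -> continuous v ->
  continuous (fun x => Num.min (u x) (v x)).
Proof. by move=> cu cv x; apply: (@continuous_min _ _ (u : R -> R^o) (v : R -> R^o)); [exact: cu|exact: cv]. Qed.

Lemma clampB (l x y : R) :
  `|Num.max (Num.min x 1) l - Num.max (Num.min y 1) l| <= `|x - y|.
Proof.
apply: (@le_trans _ _ `|Num.min x 1 - Num.min y 1|).
  move: (Num.min x 1) (Num.min y 1) => u v.
  have := ler_norm (u - v); have := ler_norm (v - u); rewrite distrC.
  move: `|u - v| => d hd1 hd2; rewrite ler_norml.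
  by have [h1|h1] := leP u l; have [h2|h2] := leP v l; apply/andP; split; lra.
have := ler_norm (x - y); have := ler_norm (y - x); rewrite distrC.
move: `|x - y| => d hd1 hd2; rewrite ler_norml.
by have [h1|h1] := leP x 1; have [h2|h2] := leP y 1; apply/andP; split; lra.
Qed.

(** Cutting the unknown off above at 1 and below at l = min (g, 0) * rho makes the
    equation Lipschitz. The solution does not feel the cut-off: it stays above l
    because rho is a positive measure, and at a maximum above 1 the right-hand side
    would be at most 1 - delta, against the maximum principle. *)
Lemma quadratic_volterra_exists g delta : feller_kernel rho -> causal g ->
  0 < delta -> (forall x, g x <= 2^-1 - delta) ->
  exists2 h, causal h &
    [/\ forall t, h t = convol (fun s => g s + 2^-1 * h s ^+ 2) rho t,
        forall t, h t <= 1 &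
        forall M t, 0 <= M -> (forall x, x <= t -> - M <= g x) -> - M <= h t].
Proof.
move=> Frho cg d0 gd; have [rho0 rho00 _] := Frho.
have cst_c (c : R) : continuous (fun _ : R => c) by move=> x; exact: cvg_cst.
pose gm x := Num.min (g x) 0.
have cgm : causal gm.
  split; first by apply: continuous_minr; [exact: (proj1 cg)|exact: cst_c].
  by move=> x x0; rewrite /gm (proj2 cg)// minxx.
pose l := convol gm rho.
have cl : causal l by exact: causal_convol.
have l0 t : l t <= 0.
  rewrite -oppr_ge0 -mulN1r -(convolZ (rho_fin _ _)); last exact: causal_bdd_meas.
  apply: Rintegral_ge0 => s _; rewrite mulN1r oppr_ge0 /gm.
  by rewrite ge_min lexx orbT.
pose cut t x := Num.max (Num.min x 1) (l t).
pose F t x := g t + 2^-1 * cut t x ^+ 2.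
have cF phi : causal phi -> causal (fun t => F t (phi t)).
  move=> [cp p0]; apply: causalD => //; apply: causalZ; split; last first.
    move=> x x0; rewrite /cut p0// (proj2 cl)// min_l// maxxx.
    by rewrite expr0n.
  have cc : continuous (fun t => cut t (phi t)).
    by apply: continuous_maxr; [apply: continuous_minr|exact: (proj1 cl)].
  by move=> x; exact: (cvgM (cc x) (cc x)).
have lF T : exists2 B, 0 <= B & forall t x y, t <= T -> `|F t x - F t y| <= B * `|x - y|.
  have [M M0 hM] := causal_bound T cl.
  exists (1 + M); first by rewrite addr_ge0.
  move=> t x y tT; have lM : - M <= l t by have := hM t tT; rewrite ler_norml => /andP[].
  have cutM z : `|cut t z| <= 1 + M.
    rewrite ler_norml; apply/andP; split.
      by rewrite /cut le_max; apply/orP; right; lra.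
    rewrite /cut ge_max ge_min; apply/andP; split; first by apply/orP; right; lra.
    by have := l0 t; lra.
  have -> : F t x - F t y = 2^-1 * (cut t x + cut t y) * (cut t x - cut t y) by rewrite /F; ring.
  rewrite normrM ler_pM// ?clampB// normrM ger0_norm//.
  have := le_trans (ler_normD (cut t x) (cut t y)) (lerD (cutM x) (cutM y)); lra.
have [h ch hE] := volterra_exists rho00 cF lF.
have bF t : bdd_meas t (fun s => F s (h s)) by apply: causal_bdd_meas; exact: cF.
have hl t : l t <= h t.
  rewrite hE; apply: le_convol => //; first exact: rho_fin.
    exact: causal_bdd_meas.
  move=> s _; rewrite /F /gm ge_min; apply/orP; left.
  by rewrite lerDl mulr_ge0// sqr_ge0.
have h1 t : h t <= 1.
  rewrite leNgt; apply/negP => ht.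
  have t0 : 0 <= t by rewrite leNgt; apply/negP => /ltW t0; move: ht; rewrite (proj2 ch)// ltr10.
  pose e := Num.min (delta / 2) ((h t - 1) / 2).
  have e0 : 0 < e by rewrite lt_min divr_gt0//= divr_gt0// subr_gt0.
  have [ed eh] : e <= delta / 2 /\ e <= (h t - 1) / 2 by rewrite !ge_min !lexx orbT.
  have [s [st /(_ t (lexx t))]] := causal_max_principle Frho (cF _ ch) t0 e0.
  rewrite -!hE /F /cut => hts hs.
  have hs1 : 1 < h s by lra.
  move: hs; rewrite (min_r (ltW hs1)) max_l; last by rewrite (le_trans (l0 s)).
  by rewrite expr1n mulr1; have := gd s; lra.
have cutE s : cut s (h s) = h s by rewrite /cut min_l// max_l.
have hE' t : h t = convol (fun s => g s + 2^-1 * h s ^+ 2) rho t.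
  by rewrite {1}hE; apply: eq_convol => s _; rewrite /F cutE.
exists h => //; split => // M t M0 gM.
have rt : fine (rho `[0%R, t]%classic) <= 1 by exact: fine_rho_le1.
apply: (@le_trans _ _ (convol (fun=> - M) rho t)).
  by rewrite convol_cst// mulNr lerN2 ler_piMr.
rewrite hE; apply: le_convol => //; [exact: rho_fin|exact: bdd_meas_cst|].
by move=> s /andP[_ st]; rewrite /F (le_trans (gM _ st))// lerDl mulr_ge0// sqr_ge0.
Qed.

(** The difference of two solutions solves a linear equation whose coefficient is
    their half-sum. *)
Lemma quadratic_volterra_unique T g h1 h2 : rho [set 0] = 0%E -> bdd_meas T g ->
  bdd_meas T h1 -> bdd_meas T h2 ->
  (forall t, 0 <= t <= T -> h1 t = convol (fun s => g s + 2^-1 * h1 s ^+ 2) rho t) ->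
  (forall t, 0 <= t <= T -> h2 t = convol (fun s => g s + 2^-1 * h2 s ^+ 2) rho t) ->
  forall t, 0 <= t <= T -> h1 t = h2 t.
Proof.
move=> rho00 bg b1 b2 e1 e2 t tT; apply/eqP; rewrite -subr_eq0; apply/eqP.
have bD : bdd_meas T (fun t => h1 t - h2 t).
  apply: bdd_measD => //; apply: (bdd_meas_eq _ (bdd_measZ (-1) b2)) => x _.
  by rewrite mulN1r.
apply: (volterra_unique rho00 (a := fun s => 2^-1 * (h1 s + h2 s)) _ bD _ tT).
  by apply: bdd_measZ; exact: bdd_measD.
move=> s sT; have /andP[_ sT'] := sT.
rewrite e1// e2// -(convolB (rho_fin _ _)).
- by apply: eq_convol => x _; ring.
- apply: bdd_measD; first exact: bdd_meas_le bg.
  by apply: bdd_measZ; apply: bdd_measX; exact: bdd_meas_le b1.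
- apply: bdd_measD; first exact: bdd_meas_le bg.
  by apply: bdd_measZ; apply: bdd_measX; exact: bdd_meas_le b2.
Qed.

End QuadraticVolterra.

(** * Solutions as power series in a perturbation *)

Section FormalSystem.
Variable R : realType.
Local Notation borel := (measurableTypeR R).
Variable rho : probability borel R.
Hypothesis rho00 : rho [set 0] = 0%E.
Implicit Types (f g h u : R -> R) (K : nat -> R -> R) (T t B M r eps : R).

(** Coefficients of eps |-> f0 + eps f. *)
Definition forcing f0 f n : R -> R :=
  if n is n'.+1 then (if n' == 0%N then f else fun=> 0) else f0.

(** The equation h = (g + h^2/2) * rho for formal power series in eps,
    with g = f0 + eps f, on [0, T]. *)
Definition formal_solution T f0 f K := forall n t, 0 <= t <= T ->
  K n t = convol (fun s => forcing f0 f n s +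
    2^-1 * \sum_(0 <= i < n.+1) K i s * K (n - i)%N s) rho t.

Lemma bdd_meas_product K T n : (forall n, bdd_meas T (K n)) ->
  bdd_meas T (fun s => 2^-1 * \sum_(0 <= i < n.+1) K i s * K (n - i)%N s).
Proof.
move=> bK; apply: bdd_measZ; apply: (@bdd_meas_sum _ _ (fun i s => K i s * K (n - i)%N s)) => i.
exact: bdd_measM.
Qed.

Lemma bdd_meas_forcing f0 f T n : bdd_meas T f0 -> bdd_meas T f -> bdd_meas T (forcing f0 f n).
Proof. by case: n => [|[|n]] //= _ _; exact: bdd_meas_cst. Qed.

(** Given the earlier coefficients, the equation of each later one is linear. *)
Lemma formal_solution_linear T f0 f K n t : formal_solution T f0 f K -> 0 <= t <= T ->
  K n.+1 t = convol (fun s => (forcing f0 f n.+1 s +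
    2^-1 * \sum_(0 <= i < n) K i.+1 s * K (n - i)%N s) + K 0%N s * K n.+1 s) rho t.
Proof.
move=> hK tT; rewrite {1}hK//; apply: eq_convol => s _.
rewrite big_nat_recl// big_nat_recr//= subn0 subnn -addrA; congr (_ + _).
rewrite [X in _ * (_ + (X + _))](_ : _ = \sum_(0 <= i < n) K i.+1 s * K (n - i)%N s); last first.
  by apply: eq_bigr => i _; rewrite subSS.
by field.
Qed.

(** Course-of-values recursion, in which L stands for the resolution of the linear
    equation with a given right-hand side. *)
Fixpoint formal_table (L : (R -> R) -> R -> R) f0 h0 f n : nat -> R -> R :=
  if n is n'.+1 then
    let K := formal_table L f0 h0 f n' in
    fun i => if i == n then
      L (fun s => forcing f0 f n s + 2^-1 * \sum_(0 <= i < n') K i.+1 s * K (n' - i)%N s)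
    else K i
  else fun i => if i == 0%N then h0 else fun=> 0.

Lemma formal_solution_exists f0 f h0 : causal f0 -> causal f -> causal h0 ->
  (forall t, 0 <= t -> h0 t = convol (fun s => f0 s + 2^-1 * h0 s ^+ 2) rho t) ->
  exists K, [/\ K 0%N = h0, forall n, causal (K n) & forall T, formal_solution T f0 f K].
Proof.
move=> cf0 cf ch0 h0E.
have [L hL] : exists L : (R -> R) -> R -> R, forall G, causal G ->
    causal (L G) /\ forall t, L G t = convol (fun s => G s + h0 s * L G s) rho t.
  suff /choice[L hL] : forall G, exists u, causal G -> causal u /\
      forall t, u t = convol (fun s => G s + h0 s * u s) rho t by exists L.
  move=> G.
  have [cG|ncG] := pselect (causal G); last by exists (fun=> 0).
  have [u cu uE] : exists2 u, causal u & forall t, u t = convol (fun s => G s + h0 s * u s) rho t.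
    apply: (@volterra_exists _ _ rho00 (fun s x => G s + h0 s * x)).
      by move=> phi cphi; apply: causalD => //; apply: causalM => //; case: ch0.
    move=> T; have [M M0 hM] := causal_bound T ch0; exists M => // t x y tT.
    by rewrite opprD addrACA subrr add0r -mulrBr normrM ler_wpM2r// hM.
  by exists u.
pose tab := formal_table L f0 h0 f; pose K n := tab n n.
have tabE m i : (i <= m)%N -> tab m i = K i.
  elim: m => [|m IH]; first by rewrite leqn0 => /eqP ->.
  rewrite leq_eqVlt => /orP[/eqP -> //|im].
  by rewrite /tab [LHS]/= ltn_eqF//; exact: IH.
pose G n s := forcing f0 f n.+1 s + 2^-1 * \sum_(0 <= i < n) K i.+1 s * K (n - i)%N s.
have KS n : K n.+1 = L (G n).
  rewrite {1}/K /tab [LHS]/= eqxx; congr L; apply/funext => s; congr (_ + _ * _).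
  apply: eq_big_nat => i /andP[_ i_n]; rewrite -/(tab n) !tabE ?leq_subr//.
have cK n : causal (K n).
  elim/ltn_ind: n => -[_|n IH]; first exact: ch0.
  rewrite KS; apply: (hL _ _).1.
  apply: causalD; first by case: n {IH} => [|n] //; exact: causal0.
  apply: causalZ; rewrite (_ : (fun x => _) = fun x => \sum_(0 <= i < n)
      (if (i < n)%N then K i.+1 x * K (n - i)%N x else 0)); last first.
    by apply/funext => x; apply: eq_big_nat => i /andP[_ ->].
  apply: (@causal_sum _ (fun i x => if (i < n)%N then K i.+1 x * K (n - i)%N x else 0)) => i.
  have [i_n|i_n] := boolP (i < n)%N; last exact: causal0.
  apply: causalM; last by apply: IH; rewrite ltnS leq_subr.
  by apply: (proj1 (IH _ _)); rewrite ltnS.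
have cG n : causal (G n).
  apply: causalD; first by case: n => [|n] //; exact: causal0.
  apply: causalZ; apply: (@causal_sum _ (fun i x => K i.+1 x * K (n - i)%N x)) => i.
  by apply: causalM => //; case: (cK i.+1).
exists K; split => // T [|n] t tT.
  have /andP[t0 _] := tT; rewrite {1}/K /tab/= h0E//; apply: eq_convol => s _.
  by rewrite big_nat1 subn0 -expr2.
rewrite {1}KS (hL _ (cG n)).2 -KS; apply: eq_convol => s _.
rewrite big_nat_recl// big_nat_recr//= subn0 subnn /G -addrA; congr (_ + _).
rewrite [X in _ = _ * (_ + (X + _))](_ : _ = \sum_(0 <= i < n) K i.+1 s * K (n - i)%N s); last first.
  by apply: eq_bigr => i _; rewrite subSS.
by have -> : K 0%N = h0 by []; field.
Qed.

Lemma formal_solution_unique T f0 f K1 K2 : bdd_meas T f0 -> bdd_meas T f ->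
  (forall n, bdd_meas T (K1 n)) -> (forall n, bdd_meas T (K2 n)) ->
  formal_solution T f0 f K1 -> formal_solution T f0 f K2 ->
  forall n t, 0 <= t <= T -> K1 n t = K2 n t.
Proof.
move=> bf0 bf b1 b2 s1 s2; elim/ltn_ind => -[_|n IH] t tT.
  apply: (quadratic_volterra_unique rho00 bf0 (b1 0%N) (b2 0%N)) tT => s sT.
    by rewrite s1//; apply: eq_convol => x _; rewrite big_nat1 subn0 -expr2.
  by rewrite s2//; apply: eq_convol => x _; rewrite big_nat1 subn0 -expr2.
apply/eqP; rewrite -subr_eq0; apply/eqP.
have bN u : bdd_meas T u -> bdd_meas T (fun x => - u x).
  by move=> bu; apply: (bdd_meas_eq _ (bdd_measZ (-1) bu)) => x _; rewrite mulN1r.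
have bD : bdd_meas T (fun t => K1 n.+1 t - K2 n.+1 t).
  by apply: bdd_measD => //; exact: bN.
apply: (volterra_unique rho00 (b1 0%N) bD _ tT) => s sT.
have /andP[s0 sT'] := sT.
have bG K : (forall n, bdd_meas T (K n)) -> bdd_meas s (fun s => (forcing f0 f n.+1 s +
    2^-1 * \sum_(0 <= i < n) K i.+1 s * K (n - i)%N s) + K 0%N s * K n.+1 s).
  move=> bK; apply: (bdd_meas_le sT'); apply: bdd_measD; last exact: bdd_measM.
  apply: bdd_measD; first exact: bdd_meas_forcing.
  apply: bdd_measZ; apply: (@bdd_meas_sum _ _ (fun i s => K i.+1 s * K (n - i)%N s)) => i.
  exact: bdd_measM.
rewrite (formal_solution_linear _ s1)// (formal_solution_linear _ s2)//.
rewrite -(convolB (rho_fin _ _))//; [|exact: bG..].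
apply: eq_convol => x /andP[x0 xs]; have xT : 0 <= x <= T by rewrite x0 (le_trans xs).
rewrite mulrBr opprD addrACA (IH 0%N)// -[X in _ = _ + X]/(- (_ * _)).
rewrite [X in X + _](_ : _ = 0) ?add0r//; apply/eqP; rewrite subr_eq0; apply/eqP.
congr (_ + _ * _); apply: eq_big_nat => i /andP[_ i_n].
by rewrite !IH// ltnS leq_subr.
Qed.

End FormalSystem.

Section Majorant.
Variable R : realType.
Local Notation borel := (measurableTypeR R).
Variable rho : probability borel R.
Hypothesis rho00 : rho [set 0] = 0%E.
Implicit Types (f g h u : R -> R) (K : nat -> R -> R) (T t B M r eps : R).

(** Each partial sum is at most A + D r s^2, where s is the previous one, and this is
    at most 2 A when s is. *)
Lemma quadratic_recursion_bound (c : nat -> R) (A D r : R) : 0 <= A -> 0 <= D -> 0 <= r ->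
  (forall n, 0 <= c n) -> c 0%N <= A ->
  (forall n, c n.+1 <= D * \sum_(0 <= i < n.+1) c i * c (n - i)%N) ->
  4 * D * A * r <= 1 -> psum_bounded c r (2 * A).
Proof.
move=> A0 D0 r0 c0 cA cS small; elim=> [|N IH].
  by rewrite big_nil mulr_ge0.
rewrite big_nat_recl//= expr0 mulr1 ger0_norm//.
have nn : forall N, \sum_(0 <= n < N) `|c n * r ^+ n| = \sum_(0 <= n < N) `|c n| * r ^+ n.
  by move=> m; apply: eq_bigr => i _; rewrite normrM normrX (ger0_norm r0).
pose e n := if (n < N)%N then c n * r ^+ n else 0.
have eA m : \sum_(0 <= n < m) `|e n| <= 2 * A.
  apply: le_trans IH; rewrite -nn.
  have [mN|Nm] := leqP m N.
    rewrite [leRHS](@big_cat_nat _ _ _ m)//=; apply: ler_wpDr; first exact: sumr_ge0.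
    by apply: ler_sum_nat => i /andP[_ im]; rewrite /e (leq_trans im).
  have z : \sum_(N <= i < m) `|e i| = 0.
    rewrite big_nat_cond big1// => i /andP[/andP[Ni _] _].
    by rewrite /e ltnNge Ni normr0.
  rewrite (@big_cat_nat _ _ _ N)//= ?(ltnW Nm)// z addr0.
  by apply: ler_sum_nat => i /andP[_ im]; rewrite /e im.
have := cauchy_product_le N eA eA => h.
have : \sum_(0 <= i < N) `|c i.+1| * r ^+ i.+1 <= D * r * (2 * A * (2 * A)).
  apply: (@le_trans _ _ (D * r * \sum_(0 <= n < N) \sum_(0 <= i < n.+1) `|e i| * `|e (n - i)%N|)); last first.
    by rewrite ler_wpM2l// mulr_ge0.
  rewrite mulr_sumr; apply: ler_sum_nat => n /andP[_ nN].
  rewrite ger0_norm//; apply: (@le_trans _ _ ((D * \sum_(0 <= i < n.+1) c i * c (n - i)%N) * r ^+ n.+1)).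
    by rewrite ler_wpM2r ?exprn_ge0.
  rewrite (_ : \sum_(0 <= i < n.+1) `|e i| * `|e (n - i)%N| =
      (\sum_(0 <= i < n.+1) c i * c (n - i)%N) * r ^+ n); last first.
    rewrite mulr_suml; apply: eq_big_nat => i /andP[_ i_n].
    rewrite /e (leq_trans i_n nN) (leq_ltn_trans (leq_subr _ _))//.
    by rewrite !ger0_norm ?mulr_ge0 ?exprn_ge0// mulrACA -exprD subnKC.
  by rewrite exprS le_eqVlt; apply/orP; left; apply/eqP; ring.
have -> : D * r * (2 * A * (2 * A)) = (4 * D * A * r) * A by ring.
move=> h2; have := ler_piMl A0 small; lra.
Qed.

(** What matters is that r depends on f0, f and K only through the bounds B and M:
    the analytic continuation below proceeds by steps of constant length. *)
Lemma formal_solution_majorant T B M : 0 <= T -> 0 <= B -> 0 <= M ->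
  exists2 r, 0 < r & forall f0 f K, bdd_meas T f0 -> bdd_meas T f ->
    (forall n, bdd_meas T (K n)) ->
    (forall t, 0 <= t <= T -> `|f t| <= M) -> (forall t, 0 <= t <= T -> `|K 0%N t| <= B) ->
    formal_solution rho T f0 f K ->
    exists c C, (forall n t, 0 <= t <= T -> `|K n t| <= c n) /\ psum_bounded c r C.
Proof.
move=> T0 B0 M0; have [beta beta0 hbeta] := exists_weight rho00 B.
(* a bound for the resolvent of the linear equation *)
pose L := 2 * expR (beta * T).
have L0 : 0 <= L by rewrite mulr_ge0// expR_ge0.
pose r := (2 * L * (L * M) + 1)^-1.
have LM0 : 0 <= 2 * L * (L * M) by rewrite !mulr_ge0.
have r0 : 0 < r by rewrite invr_gt0 ltr_wpDl.
exists r => // f0 f K bf0 bf bK fM KB sK.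
pose S n := [set `|K n t| | t in [set t | 0 <= t <= T]].
pose c n := sup (S n).
have hS n : has_sup (S n).
  split; first by exists `|K n 0|, 0 => //=; rewrite lexx.
  by have [N hN] := (bK n).2; exists N => _ [t tT <-]; exact: hN.
have Kc n t : 0 <= t <= T -> `|K n t| <= c n.
  by move=> tT; apply: (sup_upper_bound (hS n)); exists t.
have cle n x : (forall t, 0 <= t <= T -> `|K n t| <= x) -> c n <= x.
  by move=> h; apply: ge_sup; [case: (hS n)|move=> _ [t tT <-]; exact: h].
have c0 n : 0 <= c n.
  by apply: le_trans (Kc n 0 _); rewrite ?lexx.
have lin n x : 0 <= x -> (forall s, 0 <= s <= T -> `|forcing f0 f n.+1 s +
    2^-1 * \sum_(0 <= i < n) K i.+1 s * K (n - i)%N s| <= x) -> c n.+1 <= L * x.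
  move=> x0 hx; apply: cle => t tT; have /andP[t0 tT'] := tT.
  have -> : L * x = 2 * x * expR (beta * T) by rewrite /L; ring.
  apply: (@le_trans _ _ (2 * x * expR (beta * t))); last first.
    by rewrite ler_wpM2l ?mulr_ge0// ler_expR ler_wpM2l.
  apply: (@volterra_bound R rho B x T beta (K n.+1)) tT => // s sT.
  have /andP[s0 sT'] := sT; rewrite {1}(formal_solution_linear _ sK)//.
  pose G s := forcing f0 f n.+1 s + 2^-1 * \sum_(0 <= i < n) K i.+1 s * K (n - i)%N s.
  have bG : bdd_meas T G.
    apply: bdd_measD; first exact: bdd_meas_forcing.
    apply: bdd_measZ; apply: (@bdd_meas_sum _ _ (fun i s => K i.+1 s * K (n - i)%N s)) => i.
    exact: bdd_measM.
  have bGs := bdd_meas_le sT' bG.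
  have bKKs : bdd_meas s (fun s => K 0%N s * K n.+1 s).
    by apply: (bdd_meas_le sT'); exact: bdd_measM.
  have bKs := bdd_meas_le sT' (bK n.+1).
  rewrite (convolD (rho_fin _ _) bGs bKKs); apply: le_trans (ler_normD _ _) _; apply: lerD.
    apply: convol_rho_bound => // y /andP[y0 ys]; apply: hx.
    by rewrite y0 (le_trans ys).
  apply: le_trans (norm_convol (rho_fin _ _) bKKs) _.
  rewrite -(convolZ (rho_fin _ _))//; last exact: bdd_meas_norm.
  apply: le_convol; [exact: rho_fin|exact: bdd_meas_norm|by apply: bdd_measZ; exact: bdd_meas_norm|].
  move=> y /andP[y0 ys]; rewrite normrM ler_wpM2r// KB// y0 (le_trans ys)//.
have c1 : c 1%N <= L * M.
  by apply: lin => // s sT; rewrite big_geq// mulr0 addr0 fM.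
have cS n : c n.+2 <= L / 2 * \sum_(0 <= i < n.+1) c i.+1 * c (n - i).+1%N.
  rewrite -mulrA; apply: lin.
    by rewrite mulr_ge0// sumr_ge0// => i _; rewrite mulr_ge0.
  move=> s sT; rewrite add0r normrM ger0_norm// ler_wpM2l//.
  apply: le_trans (ler_norm_sum _ _ _) _; apply: ler_sum_nat => i /andP[_ i_n].
  by rewrite normrM -subSn// ler_pM// Kc.
have := @quadratic_recursion_bound (fun n => c n.+1) (L * M) (L / 2) r.
rewrite mulr_ge0// divr_ge0// ltW// => /(_ isT isT isT (fun n => c0 n.+1) c1 cS) H.
have small : 4 * (L / 2) * (L * M) * r <= 1.
  have -> : 4 * (L / 2) * (L * M) = 2 * L * (L * M) by field.
  by rewrite ler_pdivrMr ?mul1r ?lerDl// ltr_wpDl.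
exists c, (c 0%N + 2 * (L * M) * r); split => // -[|N].
  by rewrite big_nil addr_ge0// !mulr_ge0// ltW.
rewrite big_nat_recl//= expr0 mulr1 ger0_norm// lerD2l.
apply: (@le_trans _ _ ((\sum_(0 <= i < N) `|c i.+1| * r ^+ i) * r)).
  by rewrite mulr_suml; apply: ler_sum => i _; rewrite exprSr mulrA.
by rewrite ler_pM2r//; exact: H.
Qed.

(** The partial sums satisfy the equation with the partial sums of a Cauchy square in
    place of h^2, so that bounded convergence applies, for rho as for m. *)
Lemma formal_solution_sum T f0 f K c C r eps : bdd_meas T f0 -> bdd_meas T f ->
  (forall n, bdd_meas T (K n)) -> formal_solution rho T f0 f K ->
  (forall n t, 0 <= t <= T -> `|K n t| <= c n) -> psum_bounded c r C -> `|eps| <= r ->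
  exists h, [/\ bdd_meas T h,
    forall t, 0 <= t <= T -> h t = convol (fun s => (f0 s + eps * f s) + 2^-1 * h s ^+ 2) rho t &
    forall (m : {measure set borel -> \bar R}) t, (m `[0%R, t]%classic < +oo)%E -> 0 <= t <= T ->
      psum_bounded (fun n => convol (K n) m t) r (C * fine (m `[0%R, t]%classic)) /\
      pseries (fun n => convol (K n) m t) eps @ \oo --> convol h m t].
Proof.
move=> bf0 bf bK sK Kc cC epsr.
have r0 : 0 <= r by rewrite (le_trans _ epsr).
have [T0|T0] := leP 0 T; last first.
  exists (fun=> 0); split => [|t /andP[t0 tT]|m t _ /andP[t0 tT]]; first exact: bdd_meas_cst.
    by have := le_trans t0 tT; rewrite leNgt T0.
  by have := le_trans t0 tT; rewrite leNgt T0.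
have c0 n : 0 <= c n by apply: le_trans (Kc n 0 _); rewrite ?lexx.
pose P t n := K n t * eps ^+ n.
have PC t : 0 <= t <= T -> forall N, \sum_(0 <= n < N) `|P t n| <= C.
  move=> tT N; apply: le_trans (cC N); apply: ler_sum => n _.
  rewrite normrM normrX (ger0_norm (c0 n)); apply: ler_pM => //; first exact: Kc.
  by rewrite lerXn2r// nnegrE.
pose h t := limn (series (P t)).
have Ph t : 0 <= t <= T -> series (P t) @ \oo --> h t.
  by move=> tT; exact: abs_bounded_series_cvg (PC _ tT).
have PSC t : 0 <= t <= T -> forall N, `|series (P t) N| <= C.
  by move=> tT N; rewrite (le_trans (ler_norm_sum _ _ _))// PC.
have bP T' N : T' <= T -> bdd_meas T' (fun t => series (P t) N).
  move=> TT; apply: (bdd_meas_le TT).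
  apply: (@bdd_meas_sum _ _ (fun n t => K n t * eps ^+ n)) => n.
  by apply: bdd_measM => //; exact: bdd_meas_cst.
have bh : bdd_meas T h.
  by apply: (@bdd_meas_cvg _ T C (fun n t => series (P t) n)) => [n|n x xT|x xT]; [exact: bP|exact: PSC|exact: Ph].
have linear (m : {measure set borel -> \bar R}) t : (m `[0%R, t]%classic < +oo)%E -> 0 <= t <= T ->
    forall N, convol (fun s => series (P s) N) m t = pseries (fun n => convol (K n) m t) eps N.
  move=> mt /andP[t0 tT] N.
  have bKt n : bdd_meas t (K n) by exact: bdd_meas_le (bK n).
  rewrite (convol_sum mt (F := fun n s => K n s * eps ^+ n)); last first.
    by move=> n; apply: bdd_measM => //; exact: bdd_meas_cst.
  apply: eq_bigr => n _; rewrite [RHS]mulrC -(convolZ mt (eps ^+ n) (bKt n)).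
  by apply: eq_convol => s _; exact: mulrC.
have hcvg (m : {measure set borel -> \bar R}) t : (m `[0%R, t]%classic < +oo)%E -> 0 <= t <= T ->
    pseries (fun n => convol (K n) m t) eps @ \oo --> convol h m t.
  move=> mt tT; have /andP[t0 tT'] := tT; rewrite -(funext (linear m t mt tT)).
  apply: (convol_cvg mt (M := C)) => [n|n x /andP[x0 xt]|x /andP[x0 xt]].
  - exact: bP.
  - by apply: PSC; rewrite x0 (le_trans xt).
  - by apply: Ph; rewrite x0 (le_trans xt).
exists h; split => //; last first.
  move=> m t mt tT; split; last exact: hcvg.
  move=> N; apply: (@le_trans _ _ ((\sum_(0 <= n < N) `|c n| * r ^+ n) * fine (m `[0%R, t]%classic))); last first.
    by rewrite ler_wpM2r// fine_ge0.
  rewrite mulr_suml; apply: ler_sum => n _; rewrite mulrAC ler_wpM2r ?exprn_ge0//.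
  have /andP[t0 tT'] := tT; rewrite (ger0_norm (c0 n)); apply: convol_bound => //.
    exact: bdd_meas_le (bK n).
  by move=> s /andP[s0 st]; apply: Kc; rewrite s0 (le_trans st).
move=> t tT; have /andP[t0 tT'] := tT.
pose Q s n := \sum_(0 <= i < n.+1) P s i * P s (n - i)%N.
have QE s n : Q s n = eps ^+ n * \sum_(0 <= i < n.+1) K i s * K (n - i)%N s.
  rewrite mulr_sumr; apply: eq_big_nat => i /andP[_ i_n].
  by rewrite /P mulrACA -exprD subnKC// mulrC.
have Qh s : 0 <= s <= T -> series (Q s) @ \oo --> h s ^+ 2.
  by move=> sT; apply: (cauchy_product_cvg (PC _ sT) (PC _ sT)); exact: Ph.
have QC s N : 0 <= s <= T -> `|series (Q s) N| <= C * C.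
  move=> sT; apply: le_trans (cauchy_product_le N (PC _ sT) (PC _ sT)).
  apply: le_trans (ler_norm_sum _ _ _) _; apply: ler_sum => n _.
  apply: le_trans (ler_norm_sum _ _ _) _; apply: ler_sum => i _.
  by rewrite normrM.
have bQ N : bdd_meas t (fun s => series (Q s) N).
  apply: (@bdd_meas_sum _ _ (fun n s => Q s n)) => n.
  apply: (bdd_meas_le tT'); apply: (@bdd_meas_sum _ _ (fun i s => P s i * P s (n - i)%N)) => i.
  by apply: bdd_measM; apply: bdd_measM => //; exact: bdd_meas_cst.
have bg : bdd_meas t (fun s => f0 s + eps * f s).
  by apply: (bdd_meas_le tT'); apply: bdd_measD => //; exact: bdd_measZ.
have PQ N : series (P t) N.+2 = convol (fun s => f0 s + eps * f s) rho t +
    2^-1 * convol (fun s => series (Q s) N.+2) rho t.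
  rewrite -(convolZ (rho_fin _ _))// -(convolD (rho_fin _ _))//; last exact: bdd_measZ.
  transitivity (\sum_(0 <= n < N.+2) convol (fun s => eps ^+ n * (forcing f0 f n s +
     2^-1 * \sum_(0 <= i < n.+1) K i s * K (n - i)%N s)) rho t).
    apply: eq_bigr => n _; rewrite convolZ ?rho_fin//; last first.
      apply: (bdd_meas_le tT'); apply: bdd_measD; last exact: bdd_meas_product.
      exact: bdd_meas_forcing.
    by rewrite /P mulrC; congr (_ * _); exact: sK.
  rewrite -(convol_sum (rho_fin _ _)); last first.
    move=> n; apply: (bdd_meas_le tT'); apply: bdd_measZ; apply: bdd_measD; last exact: bdd_meas_product.
    exact: bdd_meas_forcing.
  apply: eq_convol => s _.
  under eq_bigr do rewrite mulrDr mulrCA -QE.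
  rewrite big_split/= -mulr_sumr; congr (_ + _).
  rewrite !big_nat_recl//= expr0 mul1r expr1 big1 ?addr0// => i _.
  by rewrite mulr0.
have l1 : (fun N => series (P t) N.+2) @ \oo --> h t.
  by rewrite (cvg_shiftS (fun N => series (P t) N.+1)) cvg_shiftS; exact: Ph.
rewrite -(cvg_lim _ l1)//; apply: cvg_lim => //.
have bh2 : bdd_meas t (fun s => h s ^+ 2) by apply: bdd_measX; exact: bdd_meas_le bh.
rewrite (convolD (rho_fin _ _) bg (bdd_measZ 2^-1 bh2)) (convolZ (rho_fin _ _) _ bh2) (funext PQ).
apply: cvgD; first exact: cvg_cst.
apply: cvgM; first exact: cvg_cst.
apply: (convol_cvg (rho_fin _ _) (M := C * C)) => [n|n x /andP[x0 xt]|x /andP[x0 xt]].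
- exact: bQ.
- by apply: QC; rewrite x0 (le_trans xt).
- have xT : 0 <= x <= T by rewrite x0 (le_trans xt).
  by rewrite (cvg_shiftS (fun N => series (Q x) N.+1)) cvg_shiftS; exact: Qh.
Qed.

End Majorant.

(** * Exponential moments and analytic continuation *)

Section MomentGeneratingFunction.
Variables (R : realType) (d : measure_display) (Omega : measurableType d).
Variable P : probability Omega R.
Implicit Types (X : Omega -> R) (r z eps : R).

Lemma exp_partial_sum_le (x : R) N : \sum_(0 <= n < N) x ^+ n / n`!%:R <= expR `|x|.
Proof.
apply: (@le_trans _ _ (series (exp_coeff `|x|) N)).
  apply: ler_sum => n _; rewrite /exp_coeff/= ler_wpM2r ?invr_ge0//.
  by rewrite (le_trans (ler_norm _))// normrX.
apply: nondecreasing_cvgn_le; last exact: is_cvg_series_exp_coeff.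
by apply: nondecreasing_series => n _ _; exact: exp_coeff_ge0.
Qed.

(** The partial sums of the series of exp (eps X) exp (z X) are dominated by
    exp ((z + r) X) + exp ((z - r) X), which allows integrating term by term. *)
Lemma mgf_power_series X z r : measurable_fun setT X -> 0 < r ->
  P.-integrable setT (EFin \o (fun w => expR ((z + r) * X w))) ->
  P.-integrable setT (EFin \o (fun w => expR ((z - r) * X w))) ->
  exists a C, psum_bounded a r C /\ forall eps, `|eps| <= r ->
    (\int[P]_w (expR ((z + eps) * X w))%:E = (limn (pseries a eps))%:E)%E.
Proof.
move=> mX r0 i1 i2.
pose dom w := expR ((z + r) * X w) + expR ((z - r) * X w).
have idom : P.-integrable setT (EFin \o dom) by have := integrableD measurableT i1 i2.
have mexp (c : R) : measurable_fun setT (fun w => expR (c * X w)).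
  by apply: measurableT_comp => //; apply: measurable_funM => //; exact: measurable_cst.
have expdom w : expR (r * `|X w|) * expR (z * X w) <= dom w.
  rewrite /dom -expRD; have [x0|x0] := leP 0 (X w).
    rewrite ger0_norm// ler_wpDr ?expR_ge0// ler_expR; lra.
  rewrite ltr0_norm// ler_wpDl ?expR_ge0// ler_expR; lra.
pose F n w := X w ^+ n / n`!%:R * expR (z * X w).
have mF n : measurable_fun setT (F n).
  apply: measurable_funM => //; apply: measurable_funM; last exact: measurable_cst.
  exact: measurable_funX.
have sumF N w : \sum_(0 <= n < N) `|F n w| * r ^+ n <= dom w.
  apply: le_trans (expdom w).
  rewrite (eq_bigr (fun n => (r * `|X w|) ^+ n / n`!%:R * expR (z * X w))); last first.
    move=> n _; rewrite /F !normrM normrX [`|_^-1|]ger0_norm ?invr_ge0//.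
    by rewrite [`|expR _|]ger0_norm ?expR_ge0// exprMn; ring.
  rewrite -mulr_suml ler_wpM2r ?expR_ge0//.
  by apply: le_trans (exp_partial_sum_le _ _) _; rewrite normrM normr_id ger0_norm// ltW.
have iF n : P.-integrable setT (EFin \o F n).
  have idr : P.-integrable setT (EFin \o (fun w => (r ^+ n)^-1 * dom w)).
    exact: (integrableZl measurableT _ idom).
  apply: (le_integrable measurableT _ _ idr); first exact/measurable_EFinP.
  move=> w _ /=; rewrite lee_fin [leRHS]ger0_norm; last first.
    by rewrite mulr_ge0 ?invr_ge0 ?exprn_ge0 ?(ltW r0)// addr_ge0 ?expR_ge0.
  rewrite ler_pdivlMl ?exprn_gt0// mulrC.
  have := sumF n.+1 w; rewrite big_nat_recr//=; apply: le_trans.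
  by rewrite lerDr sumr_ge0// => i _; rewrite mulr_ge0// exprn_ge0// ltW.
pose a n := \int[P]_w F n w.
exists a, (\int[P]_w dom w); split.
  move=> N; apply: (@le_trans _ _ (\sum_(0 <= n < N) \int[P]_w (r ^+ n * `|F n w|))).
    apply: ler_sum => n _; rewrite mulrC RintegralZl//; last exact: integrable_norm.
    by rewrite ler_wpM2l ?exprn_ge0 ?(ltW r0)// le_normr_Rintegral.
  have iFr n : P.-integrable setT (EFin \o (fun w => r ^+ n * `|F n w|)).
    by have := integrableZl measurableT (r ^+ n) (integrable_norm (iF n)).
  rewrite -Rintegral_sum//; apply: le_Rintegral => //.
    exact: integrable_sum_EFin.
  move=> w _; apply: le_trans (sumF N w); apply: ler_sum => n _.
  by rewrite mulrC.
move=> eps er.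
have cE w : (fun N => \sum_(0 <= n < N) eps ^+ n * F n w) @ \oo --> expR ((z + eps) * X w).
  rewrite (_ : (fun N => _) = fun N => series (exp_coeff (eps * X w)) N * expR (z * X w)); last first.
    apply/funext => N; rewrite /series/= mulr_suml; apply: eq_bigr => n _.
    by rewrite /F /exp_coeff/= exprMn; ring.
  rewrite mulrDl addrC expRD; apply: cvgM; last exact: cvg_cst.
  exact: is_cvg_series_exp_coeff.
have iFe n : P.-integrable setT (EFin \o (fun w => eps ^+ n * F n w)).
  by have := integrableZl measurableT (eps ^+ n) (iF n).
have iS N : P.-integrable setT (EFin \o (fun w => \sum_(0 <= n < N) eps ^+ n * F n w)).
  exact: integrable_sum_EFin.
have iE : P.-integrable setT (EFin \o (fun w => expR ((z + eps) * X w))).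
  apply: (le_integrable measurableT _ _ idom); first exact/measurable_EFinP.
  move=> w _ /=; rewrite lee_fin ger0_norm ?expR_ge0// ger0_norm ?addr_ge0 ?expR_ge0//.
  apply: le_trans (expdom w); rewrite mulrDl addrC expRD ler_wpM2r ?expR_ge0//.
  rewrite ler_expR (le_trans (ler_norm _))// normrM ler_wpM2r//.
have [| | | | | |_ _ cf] := @dominated_convergence _ _ _ P setT _
   (fun N w => (\sum_(0 <= n < N) eps ^+ n * F n w)%:E)
   (fun w => (expR ((z + eps) * X w))%:E) (EFin \o dom).
- by [].
- by move=> N; have /integrableP[] := iS N.
- by have /integrableP[] := iE.
- by apply: aeW => w _; apply: cvg_EFin; [exact: nearW|exact: cE].
- exact: idom.
- apply: aeW => w N _; rewrite lee_fin; apply: le_trans (sumF N w).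
  apply: le_trans (ler_norm_sum _ _ _) _; apply: ler_sum => n _.
  rewrite normrM normrX mulrC ler_wpM2l// lerXn2r// nnegrE// (le_trans _ er)//.
have fE := fineK (integrable_fin_num measurableT iE).
rewrite -[LHS]fE; congr (_%:E); apply/esym/cvg_lim => //.
have {}cf : (fun N => (\int[P]_w (\sum_(0 <= n < N) eps ^+ n * F n w)%:E)%E) @ \oo -->
    (fine (\int[P]_w (expR ((z + eps) * X w))%:E))%:E by rewrite [X in _ --> X]fE.
apply: cvg_trans (fine_cvg cf); apply: near_eq_cvg; apply: nearW => N /=.
rewrite -[LHS]/(Rintegral P setT (fun w => \sum_(0 <= n < N) eps ^+ n * F n w)).
rewrite Rintegral_sum//; apply: eq_bigr => n _.
by rewrite RintegralZl// mulrC.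
Qed.

End MomentGeneratingFunction.

Section Continuation.
Variables (R : realType) (d : measure_display) (Omega : measurableType d).
Local Notation borel := (measurableTypeR R).
Variables (P : probability Omega R) (mu : {measure set borel -> \bar R}).
Variables (rho : probability borel R) (xi : R.-ker Omega ~> borel).
Hypothesis hmu : loc_finite_meas mu.
Hypothesis hrho : feller_kernel rho.
Hypothesis hxi : feller_random_measure P xi mu rho.
Implicit Types (g h : R -> R) (t z : R).

Let mu_fin t : (mu `[0%R, t]%classic < +oo)%E.
Proof. by have [_] := hmu. Qed.

Let xi_fin w t : (xi w `[0%R, t]%classic < +oo)%E.
Proof. by have [H _] := hxi; have [_] := H w. Qed.

Let rho00 : rho [set 0] = 0%E.
Proof. by case: hrho. Qed.

Lemma measurable_convol_kernel g t : causal g ->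
  measurable_fun setT (fun w => convol g (xi w) t).
Proof.
move=> cg; rewrite /convol /Rintegral.
apply: measurableT_comp; first exact: fine_measurable.
have mg : measurable_fun setT ((fun s => (g (t - s))%:E) \_ `[0%R, t]%classic : borel -> \bar R).
  apply/(measurable_restrictT _ _).1; first exact: measurable_itv.
  apply/measurable_EFinP; apply: measurable_funTS.
  apply: (@measurableT_comp _ _ _ _ _ _ (g : borel -> borel)).
    by apply: continuous_measurable_fun; case: cg.
  exact: measurable_funB.
rewrite (_ : (fun w => _) = fun w => (\int[xi w]_s ((fun s => (g (t - s))%:E) \_ `[0%R, t]%classic)^\+ s -
   \int[xi w]_s ((fun s => (g (t - s))%:E) \_ `[0%R, t]%classic)^\- s)%E); last first.
  by apply/funext => w; rewrite integral_mkcond integralE.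
apply: emeasurable_funB.
  apply: (measurable_fun_integral_kernel (l := xi)) => //.
    by move=> U mU; exact: measurable_kernel.
  exact: measurable_funepos.
apply: (measurable_fun_integral_kernel (l := xi)) => //.
  by move=> U mU; exact: measurable_kernel.
exact: measurable_funeneg.
Qed.

Lemma causal_hsol g delta : causal g -> 0 < delta -> (forall x, g x <= 2^-1 - delta) ->
  exists h, [/\ causal h, is_hsol rho g h & forall M t, 1 <= M ->
    (forall x, x <= t -> - M <= g x) -> `|h t| <= M].
Proof.
move=> cg d0 gd; have [h ch [hE h1 hM]] := quadratic_volterra_exists hrho cg d0 gd.
exists h; split => //.
  split; last by move=> t _; exact: hE.
  by apply/loc_bounded_bdd_meas => T; exact: causal_bdd_meas.
move=> M t M1 gM; rewrite ler_norml (le_trans (h1 t) M1) andbT.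
by apply: hM => //; lra.
Qed.

(** Comparison with the positive part of g, to which the defining property of xi
    applies. *)
Lemma integrable_exp_convol g delta t : causal g -> 0 < delta ->
  (forall x, g x <= 2^-1 - delta) -> 0 <= t ->
  P.-integrable setT (EFin \o (fun w => expR (convol g (xi w) t))).
Proof.
move=> cg d0 gd t0; have d12 : delta <= 2^-1 by have := gd 0; rewrite (proj2 cg)//; lra.
pose gp x := Num.max (g x) 0.
have cgp : causal gp.
  split; first by apply: continuous_maxr => [|x]; [exact: (proj1 cg)|exact: cvg_cst].
  by move=> x x0; rewrite /gp (proj2 cg)// maxxx.
have gp0 x : 0 <= gp x by rewrite le_max lexx orbT.
have gpd x : gp x <= 2^-1 - delta by rewrite ge_max gd; lra.
have [h [_ hs _]] := causal_hsol cgp d0 gpd.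
have gpn x : 0 <= x -> `|gp x| <= 2^-1.
  by move=> _; rewrite ger0_norm// (le_trans (gpd x))//; lra.
have := hxi.2 gp h (causal_vanishing cgp) gpn hs t t0.
rewrite unlock => E.
have mX g' : causal g' -> measurable_fun setT (fun w => expR (convol g' (xi w) t)).
  by move=> cg'; apply: measurableT_comp => //; exact: measurable_convol_kernel.
have ip : P.-integrable setT (EFin \o (fun w => expR (convol gp (xi w) t))).
  apply/integrableP; split; first by apply/measurable_EFinP; exact: mX.
  under eq_integral do rewrite /= ger0_norm ?expR_ge0//.
  by rewrite E ltry.
apply: (le_integrable measurableT _ _ ip); first by apply/measurable_EFinP; exact: mX.
move=> w _ /=; rewrite lee_fin !ger0_norm ?expR_ge0// ler_expR.
apply: le_convol => //; [exact: causal_bdd_meas..|].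
by move=> s _; rewrite /gp le_max lexx.
Qed.

(** The functions z g along which the formula is continued analytically in z. *)
Section Ray.
Variables (g : R -> R) (t delta M : R).
Hypotheses (cg : causal g) (t0 : 0 <= t) (delta0 : 0 < delta) (M1 : 1 <= M).
Hypotheses (gd : forall x, g x <= 2^-1 - delta) (gM : forall x, - M <= g x).

Let delta12 : delta <= 2^-1.
Proof. by have := gd 0; rewrite (proj2 cg)//; lra. Qed.

Let convolZg z w : convol (fun s => z * g s) (xi w) t = z * convol g (xi w) t.
Proof. by rewrite convolZ//; exact: causal_bdd_meas. Qed.

(** The bounds on z keep z g below 1/2 - delta / 2. *)
Lemma integrable_ray z : - (4 * M)^-1 <= z <= 1 + delta ->
  P.-integrable setT (EFin \o (fun w => expR (z * convol g (xi w) t))).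
Proof.
move=> /andP[z1 z2].
have d20 : 0 < delta / 2 by rewrite divr_gt0.
have zg x : z * g x <= 2^-1 - delta / 2.
  have [z0|z0] := leP 0 z.
    apply: (@le_trans _ _ (z * (2^-1 - delta))); first by rewrite ler_wpM2l.
    apply: (@le_trans _ _ ((1 + delta) * (2^-1 - delta))).
      by rewrite ler_wpM2r// subr_ge0.
    have : 0 <= delta * delta by rewrite mulr_ge0// ltW.
    by lra.
  apply: (@le_trans _ _ (4^-1)); last by have d12 := delta12; lra.
  apply: (@le_trans _ _ ((- z) * M)).
    have -> : z * g x = - z * - g x by ring.
    by apply: ler_wpM2l; [lra|have := gM x; lra].
  have M0 : 0 <= M by apply: le_trans M1.
  apply: (@le_trans _ _ ((4 * M)^-1 * M)); first by rewrite ler_wpM2r// lerNl.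
  by rewrite invfM -mulrA mulVf ?mulr1//; apply: lt0r_neq0; exact: lt_le_trans M1.
have := integrable_exp_convol (causalZ z cg) d20 zg t0.
by under [X in EFin \o X]eq_fun do rewrite convolZg.
Qed.

Let ray_bound z : 0 <= z <= 1 -> forall x, z * g x <= 2^-1 - delta.
Proof.
move=> /andP[z0 z1] x; apply: (@le_trans _ _ (z * (2^-1 - delta))); first by rewrite ler_wpM2l.
by rewrite ler_piMl// subr_ge0.
Qed.

Lemma ray_solution z : 0 <= z <= 1 ->
  exists h, [/\ causal h, is_hsol rho (fun s => z * g s) h & forall s, `|h s| <= M].
Proof.
move=> z01; have [h [ch hh hM]] := causal_hsol (causalZ z cg) delta0 (ray_bound z01).
exists h; split => // s; apply: hM => // x _; have /andP[z0 z1] := z01.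
have := gM x; have [g0|g0] := leP 0 (g x).
  by move=> _; apply: (@le_trans _ _ 0); [rewrite oppr_le0 (le_trans _ M1)|exact: mulr_ge0].
move=> h1; apply: le_trans h1 _; rewrite -subr_ge0.
have -> : z * g x - g x = (1 - z) * - g x by ring.
by rewrite mulr_ge0//; lra.
Qed.

(** The defining property of xi at z g, which is known to begin with if |z g| <= 1/2. *)
Definition ray_formula z := forall h, is_hsol rho (fun s => z * g s) h ->
  (\int[P]_w (expR (z * convol g (xi w) t))%:E = (expR (convol h mu t))%:E)%E.

(** The step r does not depend on the base point x: both sides have power series
    expansions at x converging in a disc of fixed radius. *)
Lemma ray_step : exists2 r, 0 < r & forall x, 0 < x <= 1 ->
  (forall z, 0 <= z <= x -> ray_formula z) ->
  forall z, 0 <= z <= 1 -> z < x + r -> ray_formula z.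
Proof.
have M0 : 0 <= M by exact: le_trans M1.
have [r2 r20 hr2] := formal_solution_majorant rho00 t0 M0 M0.
(* the first two bounds serve the moments, the last one the formal solution *)
pose r := Num.min (Num.min (4 * M)^-1 delta) r2.
have r0 : 0 < r by rewrite !lt_min r20 delta0 invr_gt0 mulr_gt0//= (lt_le_trans _ M1).
have [rM rd rr2] : [/\ r <= (4 * M)^-1, r <= delta & r <= r2].
  by rewrite /r !ge_min !lexx !orbT.
exists r => // x x01 hx z z01 zr.
have /andP[x0 x1] := x01; have /andP[z0 z1] := z01.
have [zx|xz] := leP z x; first by apply: hx; rewrite z0.
have x01' : 0 <= x <= 1 by rewrite (ltW x0).
have [h0 [ch0 [_ h0E] h0M]] := ray_solution x01'.
have cxg : causal (fun s => x * g s) by exact: causalZ.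
have [K [K0 cK sK]] := formal_solution_exists rho00 cxg cg ch0 h0E.
have bK n : bdd_meas t (K n) by exact: causal_bdd_meas.
have bxg : bdd_meas t (fun s => x * g s) by exact: causal_bdd_meas.
have bg : bdd_meas t g by exact: causal_bdd_meas.
have gn s : 0 <= s <= t -> `|g s| <= M.
  by move=> _; rewrite ler_norml gM/=; have := gd s; have := delta0; have := M1; lra.
have Kn s : 0 <= s <= t -> `|K 0%N s| <= M by move=> _; rewrite K0.
have [c [C [Kc cC]]] := hr2 _ _ _ bxg bg bK gn Kn (sK t).
have cCr : psum_bounded c r C by apply: psum_bounded_le cC => //; exact: ltW.
have tt : 0 <= t <= t by rewrite t0 lexx.
pose b n := convol (K n) mu t.
have bC : psum_bounded b r (C * fine (mu `[0%R, t]%classic)).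
  have nr0 : `|0 : R| <= r by rewrite normr0 ltW.
  have [h [_ _ /(_ mu t (mu_fin t) tt)[]]] := formal_solution_sum bxg bg bK (sK t) Kc cCr nr0.
  by [].
have bE y h : `|y - x| <= r -> is_hsol rho (fun s => y * g s) h ->
    limn (pseries b (y - x)) = convol h mu t.
  move=> yr [bh hE]; have [h' [bh' h'E hcv]] := formal_solution_sum bxg bg bK (sK t) Kc cCr yr.
  have [_ hc] := hcv mu t (mu_fin t) tt.
  have -> : convol h mu t = convol h' mu t.
    apply: eq_convol => s st.
    have byg : bdd_meas t (fun s => y * g s) by exact: bdd_measZ.
    apply: (quadratic_volterra_unique rho00 byg _ bh' _ _ st).
    - exact: (loc_bounded_bdd_meas h).1.
    - by move=> u /andP[u0 _]; exact: hE.
    - move=> u ut; rewrite h'E//; apply: eq_convol => v _.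
      by congr (_ + _); ring.
  exact: cvg_lim.
have mX : measurable_fun setT (fun w => convol g (xi w) t) by exact: measurable_convol_kernel.
have i1 : P.-integrable setT (EFin \o (fun w => expR ((x + r) * convol g (xi w) t))).
  apply: integrable_ray; apply/andP; split; last lra.
  by apply: (@le_trans _ _ 0); [rewrite oppr_le0 invr_ge0 mulr_ge0|rewrite addr_ge0// ltW].
have i2 : P.-integrable setT (EFin \o (fun w => expR ((x - r) * convol g (xi w) t))).
  by apply: integrable_ray; apply/andP; split; have := delta0; lra.
have [a [Ca [aC aE]]] := mgf_power_series mX r0 i1 i2.
have ab e : - x < e <= 0 -> `|e| < r -> limn (pseries a e) = expR (limn (pseries b e)).
  move=> /andP[xe e0] er.
  have xe01 : 0 <= x + e <= 1 by apply/andP; split; lra.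
  have [h [_ hh _]] := ray_solution xe01.
  have xex : 0 <= x + e <= x by apply/andP; split; lra.
  have := hx _ xex h hh; rewrite (aE _ (ltW er)) => -[->]; congr expR.
  have h1 : `|x + e - x| <= r by rewrite addrAC subrr add0r ltW.
  by rewrite -(bE _ _ h1 hh) addrAC subrr add0r.
have zxr : `|z - x| < r by rewrite gtr0_norm ?subr_gt0//; lra.
have main := psum_exp_continuation r0 x0 aC bC ab zxr.
move=> h hh; rewrite -(bE _ _ (ltW zxr) hh) -main -(aE _ (ltW zxr)).
by apply: eq_integral => w _; rewrite subrKC.
Qed.

(** The defining property of xi gives the formula for small z, and steps of constant
    length lead from there to z = 1. *)
Lemma ray_formula1 : ray_formula 1.
Proof.
have M0 : 0 <= M by exact: le_trans M1.
(* |z g| <= 1/2 for z <= x0 *)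
pose x0 := (2 * M)^-1.
have x00 : 0 < x0 by rewrite invr_gt0 mulr_gt0// (lt_le_trans _ M1).
have x01 : x0 <= 2^-1.
  by rewrite lef_pV2 ?posrE// ?mulr_gt0// ?(lt_le_trans _ M1)//; have := M1; lra.
have base z : 0 <= z <= x0 -> ray_formula z.
  move=> /andP[z0 zx] h hh.
  have gn x : 0 <= x -> `|z * g x| <= 2^-1.
    move=> _; rewrite normrM ger0_norm//.
    have gMx : `|g x| <= M by rewrite ler_norml gM/=; have := gd x; have := delta0; have := M1; lra.
    apply: (@le_trans _ _ (x0 * M)); first by rewrite ler_pM.
    by rewrite /x0 invfM -mulrA mulVf ?mulr1//; apply: lt0r_neq0; exact: lt_le_trans M1.
  have := hxi.2 _ h (causal_vanishing (causalZ z cg)) gn hh t t0; rewrite unlock => <-.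
  by apply: eq_integral => w _; rewrite /= convolZg.
have [r r0 step] := ray_step.
have iter k : forall z, 0 <= z <= 1 -> z <= x0 + k%:R * (r / 2) -> ray_formula z.
  elim: k => [|k IH] z z01 zk.
    by apply: base; move: z01 zk => /andP[-> _]; rewrite mul0r addr0.
  pose x := Num.min 1 (x0 + k%:R * (r / 2)).
  have xk : 0 < x0 + k%:R * (r / 2) by rewrite ltr_wpDr// mulr_ge0// divr_ge0// ltW.
  have x_01 : 0 < x <= 1 by rewrite lt_min ltr01 xk ge_min lexx.
  apply: (step x x_01) => // [y /andP[y0 yx]|].
    apply: IH; first by rewrite y0 (le_trans yx)// ge_min lexx.
    by rewrite (le_trans yx)// ge_min lexx orbT.
  have /andP[_ z1] := z01; move: zk; rewrite -natr1 mulrDl mul1r /x => zk.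
  by have [h|h] := leP 1 (x0 + k%:R * (r / 2)); lra.
pose k := (Num.truncn (2 / r)).+1.
apply: (iter k); first by rewrite ler01 lexx.
have : 2 / r < k%:R by exact: truncnS_gt.
rewrite ltr_pdivrMr// => hk; lra.
Qed.

End Ray.

(** Freezing g beyond t makes it bounded and leaves both integrals unchanged; g is then
    the end z = 1 of a ray. *)
Lemma feller_exp_moment g delta t h : causal g -> 0 < delta -> 0 <= t ->
  (forall x, 0 <= x <= t -> g x <= 2^-1 - delta) ->
  bdd_meas t h ->
  (forall s, 0 <= s <= t -> h s = convol (fun s => g s + 2^-1 * h s ^+ 2) rho s) ->
  (\int[P]_w (expR (convol g (xi w) t))%:E = (expR (convol h mu t))%:E)%E.
Proof.
move=> cg d0 t0 gd bh hE.
pose gt x := g (Num.min x t).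
have cgt : causal gt by exact: causal_truncation.
have gtE s : 0 <= s <= t -> gt s = g s.
  by move=> /andP[s0 st]; rewrite /gt min_l.
have [M0 M00 hM0] := causal_bound t cg.
have M1 : 1 <= 1 + M0 by rewrite lerDl.
have gtM x : - (1 + M0) <= gt x.
  have mt : Num.min x t <= t by rewrite ge_min lexx orbT.
  by have := hM0 _ mt; rewrite ler_norml /gt => /andP[+ _]; lra.
have gtd x : gt x <= 2^-1 - delta.
  have [x0|x0] := leP 0 x; first by apply: gd; rewrite le_min x0 t0/= ge_min lexx orbT.
  have xt : Num.min x t <= 0 by rewrite ge_min ltW.
  by have := gd 0; rewrite /gt !(proj2 cg)// t0 lexx => /(_ isT).
have i01 : 0 <= (1 : R) <= 1 by rewrite ler01 lexx.
have [h' [ch' hh' _]] := ray_solution cgt d0 M1 gtd gtM i01.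
have := ray_formula1 cgt t0 d0 M1 gtd gtM hh'.
under eq_integral do rewrite mul1r.
have -> : convol h' mu t = convol h mu t.
  apply: eq_convol => s st.
  have bg : bdd_meas t g by exact: causal_bdd_meas.
  apply: (quadratic_volterra_unique rho00 bg _ bh _ _ st).
  - exact: causal_bdd_meas.
  - move=> u /andP[u0 ut]; rewrite hh'.2//; apply: eq_convol => v /andP[v0 vu].
    by rewrite mul1r gtE// v0 (le_trans vu).
  - exact: hE.
move=> <-; apply: eq_integral => w _; congr (expR _)%:E.
by apply: eq_convol => s st; rewrite gtE.
Qed.

End Continuation.

(** * Cumulants *)

Section PartialCumulants.
Variables (R : realType) (d : measure_display) (Omega : measurableType d).
Local Notation borel := (measurableTypeR R).
Variables (P : probability Omega R) (mu : {measure set borel -> \bar R}).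
Variables (rho : probability borel R) (xi : R.-ker Omega ~> borel).
Hypothesis hmu : loc_finite_meas mu.
Hypothesis hrho : feller_kernel rho.
Hypothesis hxi : feller_random_measure P xi mu rho.
Implicit Types (f g h : R -> R) (t z : R) (K : nat -> R -> R).

(** For small eps the function f0 + eps f is still below 1/2, and the solution of its
    equation is the sum of the formal solution. *)
Lemma formal_solution_partial_cumulants f0 f K delta t :
  causal f0 -> causal f -> 0 < delta -> 0 <= t ->
  (forall x, 0 <= x <= t -> f0 x <= 2^-1 - delta) ->
  (forall n, bdd_meas t (K n)) -> formal_solution rho t f0 f K ->
  has_partial_cumulants P (fun w => convol f0 (xi w) t) (fun w => convol f (xi w) t)
    (fun n => n`!%:R * convol (K n) mu t).
Proof.
move=> cf0 cf delta0 t0 f0d bK sK; have [rho0 rho00 _] := hrho.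
have [M M0 fM] := causal_bound t cf.
have fM' x : 0 <= x <= t -> `|f x| <= M by move=> /andP[_]; exact: fM.
have [B KB] := (bK 0%N).2.
have KB' s : 0 <= s <= t -> `|K 0%N s| <= `|B|.
  by move=> st; rewrite (le_trans (KB s st))// ler_norm.
have bf0 : bdd_meas t f0 by exact: causal_bdd_meas.
have bf : bdd_meas t f by exact: causal_bdd_meas.
have [r r0 hr] := formal_solution_majorant rho00 t0 (normr_ge0 B) M0.
have [c [C [Kc cC]]] := hr _ _ _ bf0 bf bK fM' KB' sK.
pose r' := Num.min r (delta / (2 * (M + 1))).
have M10 : 0 < 2 * (M + 1) by rewrite mulr_gt0// ltr_wpDl.
exists r'; first by rewrite lt_min r0 divr_gt0.
move=> eps; rewrite lt_min => /andP[er ed].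
have [h [bh hE hcv]] := formal_solution_sum bf0 bf bK sK Kc cC (ltW er).
have tt : 0 <= t <= t by rewrite t0 lexx.
have [_ hc] := hcv mu t (proj2 hmu t) tt.
exists (convol h mu t).
  apply: cvg_trans hc; apply: near_eq_cvg; apply: nearW => N.
  apply: eq_bigr => n _; have nf : n`!%:R != 0 :> R by rewrite pnatr_eq0 -lt0n fact_gt0.
  by rewrite /=; field.
have cg : causal (fun s => f0 s + eps * f s) by apply: causalD => //; exact: causalZ.
have d20 : 0 < delta / 2 by rewrite divr_gt0.
have gd x : 0 <= x <= t -> f0 x + eps * f x <= 2^-1 - delta / 2.
  move=> xt; have := f0d x xt.
  suff : eps * f x <= delta / 2 by lra.
  rewrite (le_trans (ler_norm _))// normrM.
  apply: (@le_trans _ _ (delta / (2 * (M + 1)) * (M + 1))).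
    by apply: ler_pM => //; [exact: ltW|rewrite (le_trans (fM' x xt))// lerDl].
  by rewrite invfM mulrA -mulrA mulVf ?mulr1// gt_eqF// ltr_wpDl.
rewrite unlock -(feller_exp_moment hmu hrho hxi cg d20 t0 gd bh hE).
apply: eq_integral => w _; congr (expR _)%:E.
have xit : (xi w `[0%R, t]%classic < +oo)%E by have [_] := hxi.1 w.
by rewrite convolD// ?convolZ//; exact: bdd_measZ.
Qed.

Lemma Kprime_systemP f0 f K : loc_bounded f0 -> loc_bounded f ->
  (forall n, loc_bounded (K n)) ->
  Kprime_system rho f0 f K <-> forall T, formal_solution rho T f0 f K.
Proof.
move=> /loc_bounded_bdd_meas bf0 /loc_bounded_bdd_meas bf bK.
have bK' n T : bdd_meas T (K n) by exact: (loc_bounded_bdd_meas _).1.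
have E0 t : convol (fun s => f0 s + 2^-1 * K 0%N s ^+ 2) rho t =
    convol (fun s => forcing f0 f 0 s + 2^-1 * \sum_(0 <= i < 1) K i s * K (0 - i)%N s) rho t.
  by apply: eq_convol => s _; rewrite big_nat1 subn0 expr2.
have E1 t : convol f rho t + convol (fun s => K 0%N s * K 1%N s) rho t =
    convol (fun s => forcing f0 f 1 s + 2^-1 * \sum_(0 <= i < 2) K i s * K (1 - i)%N s) rho t.
  rewrite -(convolD (rho_fin _ _))//; last exact: bdd_measM.
  apply: eq_convol => s _; rewrite big_nat_recl// big_nat1 subn0 subnn/=.
  by congr (_ + _); field.
have E2 n t : convol (fun s => 2^-1 * \sum_(0 <= i < n.+3) K i s * K (n.+2 - i)%N s) rho t =
    convol (fun s => forcing f0 f n.+2 s + 2^-1 * \sum_(0 <= i < n.+3) K i s * K (n.+2 - i)%N s) rho t.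
  by apply: eq_convol => s _; rewrite add0r.
split.
  move=> [_ [_ h0] h1 h2] T [|[|n]] t /andP[t0 _].
  - by rewrite -E0; exact: h0.
  - by rewrite -E1; exact: h1.
  - by rewrite -E2; exact: h2.
move=> H; split => //.
- by split => // t t0; rewrite E0; apply: (H t); rewrite t0 lexx.
- by move=> t t0; rewrite E1; apply: (H t); rewrite t0 lexx.
- case=> [//|[//|n]] _ t t0; rewrite E2; apply: (H t); rewrite t0 lexx//.
Qed.

Lemma eq_formal_solution T f0 f f0' f' K : (forall s, 0 <= s <= T -> f0 s = f0' s) ->
  (forall s, 0 <= s <= T -> f s = f' s) ->
  formal_solution rho T f0 f K -> formal_solution rho T f0' f' K.
Proof.
move=> e0 e1 sK n t tT; rewrite sK//; apply: eq_convol => s /andP[s0 st].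
have sT : 0 <= s <= T by have /andP[_ tT'] := tT; rewrite s0 (le_trans st).
by congr (_ + _); case: n => [|[|n]] /=; rewrite ?e0 ?e1.
Qed.

Lemma loc_bounded_continuous f : continuous_vanishing0 f -> loc_bounded f.
Proof.
move=> cf; apply/loc_bounded_bdd_meas => T.
have ce := causal_extension cf.
by apply: bdd_meas_eq (causal_bdd_meas T ce) => x /andP[x0 _]; rewrite max_l.
Qed.

(** For f0 = 0 the constant term vanishes, and what remains of the system is the
    recursion that defines Kfun. *)
Lemma Kfun_formal_solution f : causal f -> exists K,
  [/\ forall n, causal (K n), K 0%N = (fun=> 0), forall T, formal_solution rho T (fun=> 0) f K &
    forall n t, 0 <= t -> K n.+1 t = Kfun rho f n.+1 t].
Proof.
move=> cf; have [rho0 rho00 _] := hrho.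
have c0 : causal (fun=> 0 : R) by exact: causal0.
have [t t0|K [K0 cK sK]] := formal_solution_exists rho00 c0 cf c0.
  rewrite (@eq_convol _ _ _ _ (fun=> 0)) ?convol_cst ?rho_fin ?mul0r//.
  by move=> s _; rewrite add0r expr0n mulr0.
exists K; split => // n; elim/ltn_ind: n => n IH t t0.
have tt : 0 <= t <= t by rewrite t0 lexx.
rewrite (formal_solution_linear _ (sK t))// K0.
case: n IH => [|n] IH.
  by rewrite Kfun1; apply: eq_convol => s _; rewrite big_geq// mulr0 mul0r !addr0.
rewrite KfunE//; apply: eq_convol => s /andP[s0 st]; rewrite add0r mul0r addr0; congr (_ * _).
rewrite big_add1/=; apply: eq_big_nat => i /andP[_ i_n].
rewrite IH// subSS; congr (_ * _).
by rewrite subSn// IH// ltnS leq_subr.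
Qed.

End PartialCumulants.

Lemma has_cumulants_of_partial (R : realType) (d : measure_display)
    (Omega : measurableType d) (P : probability Omega R) (X Y : Omega -> R) kappa kappa' :
  (forall w, X w = 0) -> kappa' 0%N = 0 -> (forall n, kappa' n.+1 = kappa n.+1) ->
  has_partial_cumulants P X Y kappa' -> has_cumulants P Y kappa.
Proof.
move=> X0 k0 kS [delta d0 H]; exists delta => // eps /H[l lE EE]; exists l.
  apply: cvg_trans lE; apply: near_eq_cvg; apply: nearW => -[|N].
    by rewrite !big_geq.
  rewrite big_ltn// k0 mulr0 add0r big_nat [RHS]big_nat; apply: eq_bigr => -[//|n] _.
  by rewrite kS.
rewrite -EE; congr (expectation P _).
by apply/funext => w; rewrite X0 add0r.
Qed.

Theorem proposition3p7 (R : realType) (d : measure_display)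
    (Omega : measurableType d) (P : probability Omega R)
    (mu : {measure set (measurableTypeR R) -> \bar R})
    (rho : probability (measurableTypeR R) R)
    (xi : R.-ker Omega ~> measurableTypeR R)
    (f f0 : R -> R)
    (hmu : loc_finite_meas mu)
    (hrho : feller_kernel rho)
    (hxi : feller_random_measure P xi mu rho)
    (hf : continuous_vanishing0 f)
    (hf0 : continuous_vanishing0 f0) :
  ((forall n : nat, (1 <= n)%N -> loc_bounded (Kfun rho f n)) /\
   (forall t : R, 0 <= t ->
     has_cumulants P (fun w => convol f (xi w) t)
       (fun n => n`!%:R * convol (Kfun rho f n) mu t)))
  /\
  ((ereal_sup [set (f0 x)%:E | x in [set x : R | (0 <= x)%R]] < (2^-1)%:E)%E ->
   exists K : nat -> R -> R,
     [/\ Kprime_system rho f0 f K,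
         forall K2 : nat -> R -> R, Kprime_system rho f0 f K2 ->
           forall (n : nat) (t : R), 0 <= t -> K2 n t = K n t &
         forall t : R, 0 <= t ->
           exists2 kappa : nat -> R,
             has_partial_cumulants P (fun w => convol f0 (xi w) t)
               (fun w => convol f (xi w) t) kappa &
             forall n : nat, (1 <= n)%N ->
               kappa n = n`!%:R * convol (K n) mu t]).
Proof.
pose fe x := f (Num.max x 0); pose f0e x := f0 (Num.max x 0).
have cfe : causal fe by exact: causal_extension.
have cf0e : causal f0e by exact: causal_extension.
have feE s : 0 <= s -> fe s = f s by move=> s0; rewrite /fe max_l.
have f0eE s : 0 <= s -> f0e s = f0 s by move=> s0; rewrite /f0e max_l.
have convE g ge (m : {measure set (measurableTypeR R) -> \bar R}) t :
    (forall s : R, 0 <= s -> ge s = g s) -> convol g m t = convol ge m t.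
  by move=> gE; apply: eq_convol => s /andP[s0 _]; rewrite gE.
have [rho0 rho00 _] := hrho; split.
  have KfunE' n t : 0 <= t -> Kfun rho fe n.+1 t = Kfun rho f n.+1 t.
    elim/ltn_ind: n t => -[_|n IH] t t0; first by rewrite !Kfun1; exact/esym/convE.
    rewrite !KfunE//; apply: eq_convol => s /andP[s0 _]; congr (_ * _).
    apply: eq_big_nat => -[//|i] /andP[_ i_n]; rewrite IH//; congr (_ * _).
    by rewrite subSS subSn// IH// ltnS leq_subr.
  have [K [cK K0 sK KE]] := Kfun_formal_solution hrho cfe.
  have KE' n t : 0 <= t -> K n.+1 t = Kfun rho f n.+1 t.
    by move=> t0; rewrite KE// KfunE'.
  split.
    case=> // n _; apply/loc_bounded_bdd_meas => T.
    by apply: bdd_meas_eq (causal_bdd_meas T (cK n.+1)) => x /andP[x0 _]; exact: KE'.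
  move=> t t0.
  have c0 : causal (fun=> 0 : R) by exact: causal0.
  have half : 0 < (2^-1 : R) by [].
  have bK n : bdd_meas t (K n) by exact: causal_bdd_meas.
  have h0 x : 0 <= x <= t -> 0 <= 2^-1 - 2^-1 :> R by rewrite subrr.
  have := formal_solution_partial_cumulants hmu hrho hxi c0 cfe half t0 h0 bK (sK t).
  under [X in has_partial_cumulants _ _ X]eq_fun do rewrite -(convE _ _ _ _ feE).
  apply: has_cumulants_of_partial.
  - move=> w; have [_ /(_ t) xit] := hxi.1 w.
    by rewrite convol_cst// mul0r.
  - by rewrite K0 convol_cst ?mul0r ?mulr0//; exact: (proj2 hmu).
  - by move=> n; congr (_ * _); exact/esym/convE/KE'.
move=> supf0.
pose s0 := fine (ereal_sup [set (f0 x)%:E | x in [set x : R | (0 <= x)%R]]).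
have S0 : (0 <= ereal_sup [set (f0 x)%:E | x in [set x : R | (0 <= x)%R]])%E.
  by apply: ereal_sup_ubound; exists 0; rewrite /= ?lexx// hf0.2.
have Sfin : (ereal_sup [set (f0 x)%:E | x in [set x : R | (0 <= x)%R]] = s0%:E)%E.
  by rewrite fineK// ge0_fin_numE// (lt_trans supf0)// ltry.
pose delta := 2^-1 - s0.
have delta0 : 0 < delta by rewrite subr_gt0 -lte_fin -Sfin.
have f0d x : 0 <= x -> f0 x <= 2^-1 - delta.
  move=> x0; rewrite /delta subKr -lee_fin -Sfin.
  by apply: ereal_sup_ubound; exists x.
have f0ed x : f0e x <= 2^-1 - delta by apply: f0d; rewrite le_max lexx orbT.
have [h [ch [_ hE] _]] := causal_hsol hrho cf0e delta0 f0ed.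
have [K [K0 cK sK]] := formal_solution_exists rho00 cf0e cfe ch hE.
have lf0 := loc_bounded_continuous hf0; have lf := loc_bounded_continuous hf.
have lK n : loc_bounded (K n) by apply/loc_bounded_bdd_meas => T; exact: causal_bdd_meas.
have sK' T : formal_solution rho T f0 f K.
  by apply: eq_formal_solution (sK T) => s /andP[s_ge0 _]; [exact: f0eE|exact: feE].
exists K; split.
- exact: (Kprime_systemP rho lf0 lf lK).2 sK'.
- move=> K2 hK2 n t t0; have [lK2 _ _ _] := hK2.
  have sK2 := (Kprime_systemP rho lf0 lf lK2).1 hK2 t.
  apply: (formal_solution_unique rho00 _ _ _ _ sK2 (sK' t)).
  + exact: (loc_bounded_bdd_meas _).1.
  + exact: (loc_bounded_bdd_meas _).1.
  + by move=> m; exact: (loc_bounded_bdd_meas _).1.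
  + by move=> m; exact: (loc_bounded_bdd_meas _).1.
  + by rewrite t0 lexx.
- move=> t t0; exists (fun n => n`!%:R * convol (K n) mu t) => //.
  have bK n : bdd_meas t (K n) by exact: causal_bdd_meas.
  have f0ed' x : 0 <= x <= t -> f0e x <= 2^-1 - delta by move=> _; exact: f0ed.
  have := formal_solution_partial_cumulants hmu hrho hxi cf0e cfe delta0 t0 f0ed' bK (sK t).
  under [X in has_partial_cumulants _ _ X]eq_fun do rewrite -(convE _ _ _ _ feE).
  by under [X in has_partial_cumulants _ X]eq_fun do rewrite -(convE _ _ _ _ f0eE).
Qed.
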